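(* For every positive integer $k$ and every rational threshold $\rho\in (0,1)$ whose denominator is bounded above by a constant, the problem GtTHR$_\rho$-$k$SAT is in $\mathsf{NP}$.
   Context: A $k$-CNF is a conjunction of clauses each with at most $k$ literals. GtTHR$_\rho$-$k$SAT is the problem: given a $k$-CNF $\varphi$ on $n$ variables, decide whether $\varphi$ has strictly more than $\rho \cdot 2^n$ satisfying assignments. *)

(* Defs.v *)
From HB Require Import structures.
From mathcomp Require Import all_boot all_order all_algebra.
From Corelib Require Import BinNums.
Set Implicit Arguments.
Unset Strict Implicit.
Unset Printing Implicit Defensive.
Import Order.TTheory GRing.Theory Num.Theory.

Inductive move := MoveL | MoveN | MoveR.

(* A two-way infinite tape: [left_of] lists the cells to the left of the head,
   nearest first, and [right_of] those to the right; all cells not listed are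
   blank ([None]). *)
Record tape (G : Type) := Tape {
  left_of : seq (option G);
  scanned : option G;
  right_of : seq (option G)
}.

Definition tape_of_seq (G : Type) (s : seq G) : tape G :=
  let cells := map Some s in Tape [::] (head None cells) (behead cells).

Definition write_move (G : Type) (t : tape G) (a : option G * move) : tape G :=
  let: Tape l _ r := t in
  match a.2 with
  | MoveL => Tape (behead l) (head None l) (a.1 :: r)
  | MoveN => Tape l a.1 r
  | MoveR => Tape (a.1 :: l) (head None r) (behead r)
  end.

(* The tape alphabet is [A + work] plus the blank.  Tape [ord0] holds the input.
   [verdict q] is [Some b] when [q] is a halting state with answer [b]. *)
Record TM (A : finType) := {
  extra_tapes : nat;
  work : finType;
  state : finType;
  start : state;
  verdict : state -> option bool;
  delta : state -> {ffun 'I_extra_tapes.+1 -> option (A + work)} ->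
    state * {ffun 'I_extra_tapes.+1 -> option (A + work) * move}
}.

Record config (A : finType) (M : TM A) := Config {
  cstate : state M;
  ctapes : {ffun 'I_(extra_tapes M).+1 -> tape (A + work M)}
}.

Definition step (A : finType) (M : TM A) (c : config M) : config M :=
  if verdict (cstate c) is Some _ then c else
  let: (q, act) := delta (cstate c) [ffun i => scanned (ctapes c i)] in
  Config q [ffun i => write_move (ctapes c i) (act i)].

Definition init (A : finType) (M : TM A) (w : seq A) : config M :=
  Config (start M)
    [ffun i => tape_of_seq (if i == ord0 then map inl w else [::])].

Definition answer_at (A : finType) (M : TM A) (w : seq A) (t : nat) :
    option bool :=
  verdict (cstate (iter t (@step A M) (init M w))).

Definition language (A : finType) := seq A -> Prop.

Definition decides_in_time (A : finType) (M : TM A) (L : language A)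
    (T : nat -> nat) : Prop :=
  forall w : seq A, exists2 b : bool,
    answer_at M w (T (size w)) = Some b & (b <-> L w).

Definition in_P (A : finType) (L : language A) : Prop :=
  exists (M : TM A) (p : {poly nat}), decides_in_time M L (fun n => p.[n]%R).

(* The verifier reads the input [x] followed by the certificate [u], whose
   letters are tagged apart, so that no separator is needed. *)
Definition in_NP (A : finType) (L : language A) : Prop :=
  exists (V : language (A + bool)%type) (p : {poly nat}),
    in_P V /\
    forall x : seq A,
      L x <-> exists2 u : seq bool,
                size u <= p.[size x]%R & V (map inl x ++ map inr u).

(* [(i, true)] is the literal x_i and [(i, false)] its negation. *)
Definition literal (n : nat) := ('I_n * bool)%type.
Definition clause (n : nat) := seq (literal n).
Definition cnf (n : nat) := seq (clause n).
Definition assignment (n : nat) := {ffun 'I_n -> bool}.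

Definition is_kcnf (k n : nat) (phi : cnf n) : bool :=
  all (fun c : clause n => size c <= k) phi.

Definition satisfies (n : nat) (a : assignment n) (phi : cnf n) : bool :=
  all (has (fun l : literal n => a l.1 == l.2)) phi.

Definition num_sat (n : nat) (phi : cnf n) : nat :=
  #|[set a : assignment n | satisfies a phi]|.

Inductive symbol := Bit of bool | Sign of bool | NewClause.

Definition sum_of_symbol (s : symbol) : bool + bool + unit :=
  match s with
  | Bit b => inl (inl b) | Sign b => inl (inr b) | NewClause => inr tt
  end.

Definition symbol_of_sum (s : bool + bool + unit) : symbol :=
  match s with
  | inl (inl b) => Bit b | inl (inr b) => Sign b | inr tt => NewClause
  end.

Lemma sum_of_symbolK : cancel sum_of_symbol symbol_of_sum.
Proof. by case. Qed.

HB.instance Definition _ := Finite.copy symbol (can_type sum_of_symbolK).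

(* Binary numerals, least significant bit first, without leading zeros; zero is
   the empty numeral. *)
Fixpoint bits_of_pos (p : positive) : seq bool :=
  match p with
  | xH => [:: true]
  | xO p' => false :: bits_of_pos p'
  | xI p' => true :: bits_of_pos p'
  end.

Definition bits (n : nat) : seq bool :=
  if bin_of_nat n is Npos p then bits_of_pos p else [::].

Definition encode_nat (n : nat) : seq symbol := map Bit (bits n).

Definition encode_literal (n : nat) (l : literal n) : seq symbol :=
  Sign l.2 :: encode_nat l.1.

Definition encode_clause (n : nat) (c : clause n) : seq symbol :=
  NewClause :: flatten (map (@encode_literal n) c).

Definition encode_cnf (n : nat) (phi : cnf n) : seq symbol :=
  encode_nat n ++ flatten (map (@encode_clause n) phi).

Definition GtTHR_kSAT (rho : rat) (k : nat) : language symbol :=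
  fun w => exists (n : nat) (phi : cnf n),
    [/\ w = encode_cnf phi, is_kcnf k phi
      & (rho * 2%:R ^+ n < (num_sat phi)%:R)%R].

(* Main.v *)
Require Import Defs.
From mathcomp Require Import all_boot all_order all_algebra.
From HB Require Import structures.
From mathcomp Require Import zify lra.

(**
For a k-CNF phi and a set Y of variables let core_Y(phi) be the set of assignments
that satisfy every clause through a literal on Y.  The key fact is that there is a
constant V = V(k, rho) such that a tautology-free k-CNF with at least rho 2^n
satisfying assignments has a set Y of at most V variables with |core_Y| >= rho 2^n.
It is proved for sums over families of N formulas, in the stronger form that a sum
above (rho - eps) 2^n already suffices, which says that the values of such sums have
a gap below rho.  Induct on k, then on N: either some formula has many clauses on
disjoint variables, hence so few satisfying assignments that by the gap for N - 1
formulas it can be dropped, or boundedly many variables hit all clauses, and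
restricting them in all ways leaves a family of (k-1)-CNFs.

Having more than rho 2^n satisfying assignments is thus certified by Y when |core_Y| > rho 2^n, and by Y and one
satisfying assignment outside the core when |core_Y| = rho 2^n.  A certificate labels
each literal occurrence with the index of its variable in Y, if any, its value in
that assignment, and a tag exhibiting tautological clauses.  A finite automaton
evaluates the formula on all 2^V restrictions to Y, and comparing the numerals
of every pair of occurrences makes sure that labels depend on variables only.  A
machine with two working copies of the labelled formula does both in cubic time.
*)

Set Implicit Arguments.
Unset Strict Implicit.
Unset Printing Implicit Defensive.
Import Order.TTheory GRing.Theory Num.Theory.

(** * Small cores of k-CNFs *)

Lemma has_filter_predI (T : eqType) (a p : pred T) (s : seq T) :
  has a (filter p s) = has (predI a p) s.
Proof. by rewrite !has_filter filter_predI. Qed.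

(** * Flipping one variable *)

Section Flip.
Variables (n : nat) (v : 'I_n).
Implicit Type b : assignment n.

Definition flip b : assignment n := [ffun i => b i (+) (i == v)].

Lemma flipK : involutive flip.
Proof. by move=> b; apply/ffunP=> i; rewrite !ffunE addbK. Qed.

Lemma flip_at b : flip b v = ~~ b v.
Proof. by rewrite ffunE eqxx addbT. Qed.

Lemma flip_other b i : i != v -> flip b i = b i.
Proof. by move=> /negbTE iv; rewrite ffunE iv addbF. Qed.

Lemma card_flip_half (Q : pred (assignment n)) x :
  (forall b, Q (flip b) = Q b) -> #|Q| = 2 * #|[pred b | Q b && (b v == x)]|.
Proof.
move=> QF; rewrite -(cardID [pred b : assignment n | b v == x] Q) mul2n -addnn.
congr (_ + _); rewrite -[RHS](card_image (can_inj flipK)); apply: eq_card => b.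
apply/idP/imageP => [|[c]]; rewrite !inE.
  case/andP=> bx Qb; exists (flip b); last by rewrite flipK.
  rewrite inE QF flip_at -[Q b]/(b \in Q) Qb.
  by move: bx; case: (b v); case: (x).
case/andP=> Qc cx ->; rewrite flip_at -topredE /= QF Qc andbT.
by move: cx; case: (c v); case: (x).
Qed.

(** Each [Q x] splits into two equal halves by the value at [v]; the right-hand set joins the half
    of [Q false] with value false to the half of [Q true] with value true. *)
Lemma card_flip_mix (Q : bool -> pred (assignment n)) :
  (forall x b, Q x (flip b) = Q x b) ->
  #|Q false| + #|Q true| = 2 * #|[pred b : assignment n | Q (b v) b]|.
Proof.
move=> QF; rewrite (card_flip_half false (QF false)) (card_flip_half true (QF true)).
rewrite -mulnDr -(cardID [pred b : assignment n | b v] [pred b : assignment n | Q (b v) b]) addnC.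
congr (_ * (_ + _)); apply: eq_card => b; rewrite !inE.
  by case: (b v); rewrite ?andbF ?andbT.
by case: (b v); rewrite ?andbF ?andbT.
Qed.

End Flip.

(** * Cores and restrictions *)

Section Core.
Variable n : nat.
Implicit Types (P : pred 'I_n) (c : clause n) (phi : cnf n) (b : assignment n).

Definition core P phi : nat :=
  #|[pred b : assignment n | all (has (fun l : literal n => P l.1 && (b l.1 == l.2))) phi]|.

Lemma core_predT phi : core xpredT phi = num_sat phi.
Proof. by rewrite /core /num_sat cardsE. Qed.

Lemma eq_core P P' phi : P =1 P' -> core P phi = core P' phi.
Proof.
move=> e; apply: eq_card => b; rewrite !inE; apply: eq_all => c.
by apply: eq_has => l; rewrite e.
Qed.

(** The variable [v] leaves the formula but not the assignments, so every count is still taken over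
    all [2 ^ n] of them. *)
Definition restrict (v : 'I_n) x phi : cnf n :=
  [seq [seq l <- c | l.1 != v] | c : clause n <- phi & (v, x) \notin c].

(** An assignment [b] lies in the core on [P] and [v] exactly when it lies in the core on [P] of the
    restriction by its own value [b v]. Both restrictions ignore [v], so [card_flip_mix] gives the
    factor 2. *)
Lemma core_split v P phi :
  core P (restrict v false phi) + core P (restrict v true phi) =
  2 * core (fun i => (i == v) || P i) phi.
Proof.
rewrite {1 2}/core.
pose Q x : pred (assignment n) := fun b =>
  all (has (fun l : literal n => P l.1 && (b l.1 == l.2))) (restrict v x phi).
rewrite -[LHS]/(#|Q false| + #|Q true|) (card_flip_mix (v := v)) => [|x b]; last first.
  rewrite /Q /restrict !all_map; apply: eq_all => c /=.
  rewrite !has_filter_predI; apply: eq_has => l /=.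
  by case: (eqVneq l.1 v) => [|lv]; rewrite ?andbF ?andbT // flip_other.
congr (2 * _); apply: eq_card => b; rewrite !inE /Q /restrict all_map all_filter.
apply: eq_all => c /=; rewrite has_filter_predI.
apply/implyP/hasP => [H|[[i x] lc /=] /andP[/orP[/eqP iv|Pi] /eqP bi] vc].
- have [vc|/H/hasP[l lc /=]] := boolP ((v, b v) \in c).
    by exists (v, b v); rewrite //= !eqxx.
  by case/andP=> /andP[Pl bl] lv; exists l; rewrite // Pl orbT.
- by move: vc; rewrite -iv bi lc.
- apply/hasP; exists (i, x) => //=; rewrite Pi bi eqxx /=.
  by apply: contraNneq vc => <-; rewrite bi.
Qed.

Definition split_at (v : 'I_n) (F : seq (cnf n)) : seq (cnf n) :=
  flatten [seq [:: restrict v false phi; restrict v true phi] | phi <- F].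

Definition split_all (H : seq 'I_n) F := foldl (fun F v => split_at v F) F H.

Lemma size_split_all H F : size (split_all H F) = size F * 2 ^ size H.
Proof.
elim: H F => [|v H IH] F /=; first by rewrite muln1.
rewrite IH expnS mulnA; congr (_ * _).
by elim: F => //= phi F IHF; rewrite IHF.
Qed.

Lemma sum_core_split_all H P F :
  \sum_(phi <- split_all H F) core P phi =
  2 ^ size H * \sum_(phi <- F) core (fun i => (i \in H) || P i) phi.
Proof.
elim: H F => [|v H IH] F /=; first by rewrite mul1n.
rewrite IH expnSr -mulnA; congr (_ * _).
rewrite big_flatten big_map /= big_distrr /=; apply: eq_bigr => phi _.
rewrite !big_cons big_nil addn0 core_split; congr (_ * _).
by apply: eq_core => i; rewrite inE orbA.
Qed.

Definition taut_free phi : bool :=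
  all (fun c : clause n => all (fun l : literal n => (l.1, ~~ l.2) \notin c) c) phi.

(** Empty clauses are exempt: no variable can hit them, and they obey every bound on clause
    length. *)
Definition hits (H : seq 'I_n) phi : bool :=
  all (fun c : clause n => (c == [::]) || has (fun l : literal n => l.1 \in H) c) phi.

Lemma hits_cat H H' phi : hits H phi || hits H' phi -> hits (H ++ H') phi.
Proof.
by case/orP; apply: sub_all => c /orP[->//|h]; apply/orP; right; apply: sub_has h => l;
  rewrite mem_cat => ->; rewrite ?orbT.
Qed.

Lemma taut_free_restrict v x phi : taut_free phi -> taut_free (restrict v x phi).
Proof.
move=> /allP tf; apply/allP => _ /mapP[c + ->]; rewrite mem_filter => /andP[_ /tf /allP tfc].
apply/allP => l; rewrite mem_filter => /andP[_ /tfc].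
by rewrite mem_filter negb_and => ->; rewrite orbT.
Qed.

Lemma mem_split_all (Q : cnf n -> Prop) H F :
  (forall v x phi, Q phi -> Q (restrict v x phi)) ->
  (forall phi, phi \in F -> Q phi) -> forall phi, phi \in split_all H F -> Q phi.
Proof.
move=> Qr; elim: H F => [//|v H IH] F QF /=; apply: IH => psi.
by case/flatten_mapP=> phi /QF Qphi; rewrite !inE => /orP[]/eqP->; apply: Qr.
Qed.

(** The invariant is that every clause of full length [k.+1] meets the part of [H] yet to be split
    on. Restricting [v] drops or shortens a clause, or leaves it unchanged, and then a later
    variable hits it. *)
Lemma kcnf_split_all k H F :
  (forall phi, phi \in F -> is_kcnf k.+1 phi /\ hits H phi) ->
  forall phi, phi \in split_all H F -> is_kcnf k phi.
Proof.
pose Q (H : seq 'I_n) phi := all (fun c : clause n => (size c <= k) ||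
  (size c == k.+1) && has (fun l : literal n => l.1 \in H) c) phi.
have QN phi : Q [::] phi -> is_kcnf k phi.
  by apply: sub_all => c; rewrite has_pred0 andbF orbF.
have QF F' : (forall phi, phi \in F' -> Q H phi) ->
    forall phi, phi \in split_all H F' -> is_kcnf k phi.
  elim: H F' => [|v H IH] F' QF' /=; first by move=> phi /QF'/QN.
  apply: IH => psi /flatten_mapP[phi /QF' Qphi psiE].
  have {psiE} [x ->] : exists x, psi = restrict v x phi.
    by move: psiE; rewrite !inE => /orP[]/eqP->; [exists false | exists true].
  apply/allP => _ /mapP[c + ->]; rewrite mem_filter => /andP[_ /(allP Qphi)].
  case/orP=> [sc|/andP[/eqP sc hc]].
    by rewrite (leq_trans _ sc) // size_filter count_size.
  have [vc|vc] := boolP (has (fun l : literal n => l.1 == v) c).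
    rewrite -ltnS -sc size_filter -(count_predC (fun l : literal n => l.1 == v) c).
    by rewrite -[X in X < _]add0n ltn_add2r -has_count vc.
  have -> : [seq l <- c | l.1 != v] = c.
    by apply/all_filterP; rewrite all_predC.
  rewrite sc eqxx ltnn /=; have /hasP[l lc] := hc.
  rewrite inE => /orP[lv|lH]; last by apply/hasP; exists l.
  by case/hasP: vc; exists l.
move=> hF; apply: QF => phi /hF[/allP k1 /allP hit]; apply/allP => c cphi.
have /orP[/eqP->//|->] := hit c cphi.
by rewrite andbT -[size c <= k]ltnS orbC -leq_eqVlt; apply: k1.
Qed.

End Core.

(** * Formulas with many disjoint clauses *)

Section Rare.
Variable n : nat.
Implicit Types (S : pred (assignment n)) (c : clause n) (phi : cnf n).

(** The literals are falsified one at a time: one on a new variable halves the set, since [S] and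
    the other literals ignore that variable; a repeated one costs nothing; an opposite one is
    excluded. *)
Lemma card_falsify c S :
  all (fun l : literal n => (l.1, ~~ l.2) \notin c) c ->
  (forall v b, v \in map fst c -> S (flip v b) = S b) ->
  #|S| <= 2 ^ size c *
    #|[pred b : assignment n | S b & all (fun l : literal n => b l.1 != l.2) c]|.
Proof.
elim: c => [|l c IH] /=.
  move=> _ _; rewrite mul1n; apply: subset_leq_card; apply/subsetP => b.
  by rewrite inE andbT.
move=> /andP[lc tf] Sf.
have tfc : all (fun l : literal n => (l.1, ~~ l.2) \notin c) c.
  by apply: sub_all tf => l'; rewrite inE negb_or => /andP[].
have {}IH := IH tfc (fun v b vc => Sf v b (mem_behead (s := _ :: _) vc)).
apply: leq_trans IH _; rewrite expnS.
set T := [pred b | S b & all _ c].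
have [lin|lout] := boolP (l \in c).
  rewrite [2 * _]mulnC -mulnA leq_mul2l; apply/orP; right.
  apply: leq_trans (leq_pmull _ (isT : 0 < 2)); apply: subset_leq_card.
  by apply/subsetP => b; rewrite !inE => /andP[-> /= h]; rewrite h (allP h).
rewrite (card_flip_half (v := l.1) (Q := T) (~~ l.2)) => [|b].
  rewrite [2 * 2 ^ _]mulnC -mulnA !leq_mul2l; apply/orP; right; apply/orP; right.
  apply: subset_leq_card; apply/subsetP => b; rewrite !inE => /andP[/andP[-> ->] /eqP->].
  by rewrite andbT; case: l.2.
rewrite /= Sf ?mem_head //; congr (_ && _); apply: eq_in_all => l' l'c.
rewrite flip_other //; apply: contra lout => /eqP e.
have := l'c; rewrite (surjective_pairing l') e; have [->|] := eqVneq l'.2 l.2.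
  by rewrite -surjective_pairing.
move=> ne; have -> : l'.2 = ~~ l.2 by move: ne; case: l'.2; case: l.2.
by move: lc; rewrite inE negb_or => /andP[_ /negbTE->].
Qed.

(** [H] collects the variables of greedily chosen disjoint clauses, and [S] demands that all of
    these hold. A further clause avoiding [H] is independent of [S], so demanding it multiplies the
    size by at most [1 - 1 / 2 ^ K]. *)
Lemma greedy_hitting K phi m : taut_free phi -> is_kcnf K phi ->
  exists2 H : seq 'I_n, size H <= m * K & hits H phi \/
  exists S, [/\ forall b, satisfies b phi -> S b,
    forall v b, v \notin H -> S (flip v b) = S b &
    #|S| * (2 ^ K) ^ m <= (2 ^ K).-1 ^ m * 2 ^ n].
Proof.
move=> /allP tf /allP kphi; elim: m => [|m [H szH [hit|[S [satS Sf cardS]]]]].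
- exists [::] => //; right; exists xpredT; split => //.
  by rewrite card_ffun card_bool card_ord muln1 mul1n.
- by exists H; [apply: leq_trans szH _; rewrite leq_mul2r leqnSn orbT | left].
have [hit|/allPn[c cphi]] := boolP (hits H phi).
  by exists H; [apply: leq_trans szH _; rewrite leq_mul2r leqnSn orbT | left].
rewrite negb_or => /andP[_ /hasPn cH].
exists (map fst c ++ H); first by rewrite size_cat size_map mulSn leq_add // kphi.
right; exists [pred b : assignment n | S b & has (fun l : literal n => b l.1 == l.2) c].
split=> [b bphi|v b|].
- by rewrite /= satS //= (allP bphi).
- rewrite mem_cat negb_or => /andP[vc vH] /=; rewrite Sf //; congr (_ && _).
  apply: eq_in_has => l lc; rewrite flip_other //.
  by apply: contraNneq vc => <-; apply: map_f.
set F := [pred b : assignment n | S b & all (fun l : literal n => b l.1 != l.2) c].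
have leF : #|S| <= 2 ^ K * #|F|.
  apply: leq_trans (card_falsify (tf c cphi) (S := S) _) _ => [v b|].
    by case/mapP=> l lc ->; apply: Sf; apply: cH.
  by rewrite leq_mul2r leq_exp2l // kphi ?orbT.
have cardSF : #|S| = #|[pred b : assignment n | S b & has (fun l : literal n => b l.1 == l.2) c]| + #|F|.
  rewrite -(cardID [pred b : assignment n | has (fun l : literal n => b l.1 == l.2) c] S).
  apply: f_equal2; apply: eq_card => b; rewrite !inE; first by rewrite andbC.
  by rewrite -all_predC andbC.
move: cardSF leF cardS; set a := #|S|; set f := #|F|; set s := #|_|; clear.
rewrite !expnS; set X := (2 ^ K) ^ m; set Y := (2 ^ K).-1 ^ m.
have : 0 < 2 ^ K by rewrite expn_gt0.
case: (2 ^ K) X Y => // N X Y _ /= -> leF leX.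
(* Here [2 ^ K] is [N.+1], and the falsifying part [f] is at least a fraction [1 / N.+1] of
   [s + f]. *)
have leN : s * N.+1 <= (s + f) * N by nia.
rewrite mulnA; apply: leq_trans (_ : (s + f) * N * X <= _); first by rewrite leq_mul2r leN orbT.
by rewrite mulnAC mulnC -mulnA leq_mul2l leX orbT.
Qed.

End Rare.

(** This is [(1 + 1/N)^m >= 1 + m/N] with denominators cleared; it turns the geometric decay of
    [greedy_hitting] into an explicit bound. *)
Lemma bernoulli N m : N ^ m * (N + m) <= N.+1 ^ m * N.
Proof.
elim: m => [|m IH]; first by rewrite addn0.
rewrite !expnS -mulnA; apply: leq_trans (_ : N.+1 * (N ^ m * (N + m)) <= _).
  by rewrite mulnCA [X in _ <= X]mulnCA leq_mul2l; apply/orP; right; nia.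
by rewrite -mulnA leq_mul2l IH orbT.
Qed.

(** * The gap below a threshold *)

Section Gap.
Local Open Scope ring_scope.

Lemma hitting_or_rare K (eps : rat) : 0 < eps ->
  exists h : nat, forall n (phi : cnf n), taut_free phi -> is_kcnf K phi ->
    (exists2 H : seq 'I_n, (size H <= h)%N & hits H phi) \/
    (num_sat phi)%:R <= eps * 2%:R ^+ n.
Proof.
(* After [m.+1] disjoint clauses the density is at most [N / (N + m.+1)] with [N = 2 ^ K - 1], hence
   at most [eps] once [m >= N / eps]. *)
move=> eps0; pose m := Num.bound ((2 ^ K).-1%:R / eps).
have mP : (2 ^ K).-1%:R <= eps * m%:R :> rat.
  rewrite mulrC -ler_pdivrMr //; apply: ltW; apply: archi_boundP.
  by rewrite divr_ge0 // ltW.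
exists (m.+1 * K)%N => n phi tf kphi.
have [H szH [hit|[S [satS _ cardS]]]] := greedy_hitting m.+1 tf kphi.
  by left; exists H.
right; have leS : (num_sat phi <= #|S|)%N.
  by apply: subset_leq_card; apply/subsetP => b; rewrite inE; apply: satS.
have : (num_sat phi * m.+1 <= (2 ^ K).-1 * 2 ^ n)%N.
  have := bernoulli (2 ^ K).-1 m.+1; rewrite prednK ?expn_gt0 //.
  move: leS cardS; set s := num_sat _; set a := #|S|; set X := ((2 ^ K) ^ m.+1)%N.
  set Y := (_ ^ m.+1)%N; set N := (2 ^ K).-1; set E := (2 ^ n)%N => leS cardS ber.
  have X0 : (0 < X)%N by rewrite !expn_gt0.
  rewrite -(leq_pmul2l X0).
  have h1 : (X * (s * m.+1) <= Y * E * m.+1)%N.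
    rewrite mulnA leq_mul2r (leq_trans _ cardS) ?orbT // mulnC leq_mul2r leS orbT //.
  apply: leq_trans h1 _; rewrite mulnAC [X in (_ <= X)%N]mulnA leq_mul2r; apply/orP; right.
  by apply: leq_trans ber; rewrite leq_mul2l leq_addl orbT.
move=> le; have {le} : (num_sat phi)%:R * m.+1%:R <= (2 ^ K).-1%:R * 2%:R ^+ n :> rat.
  by rewrite -natrX -!natrM ler_nat.
move=> le; rewrite -(ler_pM2r (x := m.+1%:R)) ?ltr0Sn //; apply: le_trans le _.
rewrite mulrAC ler_wpM2r ?exprn_ge0 //; apply: le_trans mP _.
by rewrite ler_pM2l // ler_nat.
Qed.

(** [V] and [eps] are uniform in [n]. Families appear because splitting on [j] variables turns a
    formula into [2 ^ j] restrictions; this scales [rho] by [2 ^ j], so [rho] ranges over all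
    rationals. *)
Definition core_bound k N (rho : rat) V (eps : rat) : Prop :=
  forall n (F : seq (cnf n)), size F = N ->
    (forall phi, phi \in F -> taut_free phi /\ is_kcnf k phi) ->
    (rho - eps) * 2%:R ^+ n < (\sum_(phi <- F) num_sat phi)%:R ->
    exists2 Y : seq 'I_n, (size Y <= V)%N &
      rho * 2%:R ^+ n <= (\sum_(phi <- F) core (mem Y) phi)%:R.

(** [eps] is the distance from [rho] down to the largest integer strictly below it. *)
Lemma integer_gap (rho : rat) :
  exists2 eps : rat, 0 < eps & forall t : nat, rho - eps < t%:R -> rho <= t%:R.
Proof.
exists (rho - (Num.ceil rho - 1)%:~R) => [|t].
  by rewrite subr_gt0 ceilB1_lt.
rewrite opprB addrC subrK => lt; apply: le_trans (ceil_ge rho) _.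
by move: lt; rewrite -[t%:R]/(t%:Z%:~R) ltr_int ler_int ltrBlDr ltzD1.
Qed.

Lemma core_bound_weaken k N rho V V' eps eps' :
  (V <= V')%N -> eps' <= eps -> core_bound k N rho V eps -> core_bound k N rho V' eps'.
Proof.
move=> leV le h n F szF kF lt; have [|Y szY coreY] := h n F szF kF.
  by apply: le_lt_trans lt; rewrite ler_wpM2r ?exprn_ge0 // lerB.
by exists Y => //; apply: leq_trans szY leV.
Qed.

(** The hitting set is only known to have at most [h] elements, so the bounds for its finitely many
    possible sizes are merged. *)
Lemma core_bound_uniform k N rho h :
  (forall j, exists V, exists2 eps, 0 < eps & core_bound k (N * 2 ^ j) (2%:R ^+ j * rho) V eps) ->
  exists V, exists2 eps, 0 < eps &
    forall j, (j <= h)%N -> core_bound k (N * 2 ^ j) (2%:R ^+ j * rho) V eps.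
Proof.
move=> ex; elim: h => [|h [V [eps eps0 IH]]].
  by have [V [eps eps0 b]] := ex 0; exists V, eps => // j; rewrite leqn0 => /eqP->.
have [V' [eps' eps'0 b]] := ex h.+1.
exists (maxn V V'), (Num.min eps eps'); first by rewrite lt_min eps0.
move=> j; rewrite leq_eqVlt => /orP[/eqP->|/IH b'].
  by apply: core_bound_weaken b; rewrite ?leq_maxr // ge_min lexx orbT.
by apply: core_bound_weaken b'; rewrite ?leq_maxl // ge_min lexx.
Qed.

(** All clauses are empty, so the formula is empty or unsatisfiable. Sums of cores are then integer
    multiples of [2 ^ n], and [integer_gap] settles the base case. *)
Lemma kcnf0_core n P (phi : cnf n) : is_kcnf 0 phi ->
  core P phi = ((phi == [::]) * 2 ^ n)%N.
Proof.
case: phi => [_|c phi /= /andP[]].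
  by rewrite mul1n /core (eq_card (B := predT)) // card_ffun card_bool card_ord.
by rewrite leqn0 => /nilP-> _; rewrite /core mul0n; apply: eq_card0 => b; rewrite inE.
Qed.

Lemma core_bound_exists k N rho :
  exists V, exists2 eps, 0 < eps & core_bound k N rho V eps.
Proof.
elim: k N rho => [|k IHk] N rho.
  have [eps eps0 gap] := integer_gap rho; exists 0%N, eps => // n F _ kF lt.
  exists [::] => //.
  have e P : (\sum_(phi <- F) core P phi = (\sum_(phi <- F) (phi == [::])) * 2 ^ n)%N.
    by rewrite big_distrl /= !big_seq; apply: eq_bigr => phi /kF[_ /kcnf0_core->].
  move: lt; under eq_bigr do rewrite -core_predT; rewrite !e natrM natrX.
  by rewrite ltr_pM2r ?exprn_gt0 // ler_pM2r ?exprn_gt0 //; apply: gap.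
elim: N => [|N [V1 [e1 e10 IHN]]].
  have [eps eps0 gap] := integer_gap rho; exists 0%N, eps => // n [|//] _ _ lt.
  exists [::] => //; move: lt; rewrite !big_nil pmulr_llt0 ?exprn_gt0 // => lt.
  by rewrite pmulr_lle0 ?exprn_gt0 //; apply: (gap 0%N).
have e12 : 0 < e1 / 2%:R by rewrite divr_gt0.
have [h hP] := hitting_or_rare k.+1 e12.
have [V2 [e2 e20 IH2]] := core_bound_uniform (N.+1 * h) (fun j => IHk (N.+1 * 2 ^ j)%N (2%:R ^+ j * rho)).
(* Dropping a rare formula costs at most [e1 / 2] on top of a slack of [e1 / 2]. Splitting on [H]
   scales the slack by at most [2 ^ (N.+1 * h)], and [H] joins the set found for the
   restrictions. *)
exists (maxn V1 (N.+1 * h + V2)), (Num.min (e1 / 2%:R) (e2 / 2%:R ^+ (N.+1 * h))).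
  by rewrite lt_min e12 divr_gt0 ?exprn_gt0.
set eps := Num.min _ _ => n F szF kF lt.
have [[phi phiF rare]|[H szH hitH]] : (exists2 phi, phi \in F & (num_sat phi)%:R <= e1 / 2%:R * 2%:R ^+ n) \/
    exists2 H : seq 'I_n, (size H <= N.+1 * h)%N & forall phi, phi \in F -> hits H phi.
- rewrite -szF; elim: F kF {szF lt} => [|phi F IH] kF; first by right; exists [::].
  have [tf kphi] := kF phi (mem_head _ _).
  have [[H szH hH]|] := hP n phi tf kphi; last by left; exists phi; rewrite ?mem_head.
  have [psi psiF|[psi psiF r]|[H' szH' hH']] := IH; first by apply: kF; rewrite inE psiF orbT.
    by left; exists psi; rewrite // inE psiF orbT.
  right; exists (H ++ H'); first by rewrite size_cat mulSn leq_add.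
  move=> psi; rewrite inE => /orP[/eqP->|/hH' h']; first by rewrite hits_cat ?hH.
  by rewrite hits_cat ?h' ?orbT.
- have [||| Y szY coreY] := IHN n (rem phi F).
  + by rewrite size_rem // szF.
  + by move=> psi /mem_rem/kF.
  + move: lt; rewrite (big_rem phi phiF) /= natrD -ltrBlDl; apply: le_lt_trans.
    rewrite lerBrDr; apply: le_trans (lerD (lexx _) rare) _; rewrite -mulrDl.
    rewrite ler_pM2r ?exprn_gt0 //.
    have : eps <= e1 / 2%:R by rewrite ge_min lexx.
    lra.
  exists Y; first by rewrite leq_max szY.
  apply: le_trans coreY _; rewrite (big_rem phi phiF) /= natrD lerDr.
  by rewrite ler0n.
have [||| Y szY coreY] := IH2 _ szH n (split_all H F).
- by rewrite size_split_all szF.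
- move=> psi psiF; split.
    move: psi psiF; apply: (mem_split_all (Q := fun psi => taut_free psi)) => [v x psi|psi /kF[]//].
    exact: taut_free_restrict.
  by apply: kcnf_split_all psiF => phi phiF; split; [case: (kF phi phiF) | apply: hitH].
- under eq_bigr do rewrite -core_predT; rewrite sum_core_split_all natrM natrX.
  rewrite (eq_bigr (@num_sat n)) => [|phi _]; last first.
    by rewrite -core_predT; apply: eq_core => i; rewrite orbT.
  apply: le_lt_trans (_ : 2%:R ^+ size H * ((rho - eps) * 2%:R ^+ n) < _); last first.
    by rewrite ltr_pM2l ?exprn_gt0.
  rewrite mulrA ler_pM2r ?exprn_gt0 // mulrBr lerB //.
  have : eps <= e2 / 2%:R ^+ (N.+1 * h) by rewrite ge_min lexx orbT.
  rewrite ler_pdivlMr ?exprn_gt0 // => le; apply: le_trans le; rewrite mulrC.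
  rewrite ler_wpM2l //; first by rewrite ltW // lt_min e12 divr_gt0 ?exprn_gt0.
  by rewrite ler_eXn2l // ltr1n.
exists (H ++ Y).
  by rewrite size_cat leq_max leq_add ?orbT.
move: coreY; rewrite sum_core_split_all natrM natrX -mulrA ler_pM2l ?exprn_gt0 //.
rewrite (eq_bigr (core (mem (H ++ Y)))) // => phi _; apply: eq_core => i.
by rewrite /= mem_cat.
Qed.

End Gap.

(** * A Turing machine checking annotated words *)

(* Comparison of numerals written least significant bit first: a later
   difference overrides the earlier ones.  [None] means equal, [Some true] that
   the first numeral is larger. *)
Fixpoint compare_bits (c : option bool) (s t : seq bool) : option bool :=
  match s, t with
  | [::], [::] => c
  | [::], _ :: _ => Some false
  | _ :: _, [::] => Some true
  | x :: s', y :: t' => compare_bits (if x == y then c else Some x) s' t'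
  end.

Lemma verdict_iter (A : finType) (M : TM A) (c : config M) b d :
  verdict (cstate c) = Some b -> verdict (cstate (iter d (@step _ M) c)) = Some b.
Proof. by move=> cb; elim: d => //= d IH; rewrite /step IH. Qed.

Section Machine.
Variables (A : finType) (J : nat).

Definition label := 'I_J.+1.
(* [None] is a left end marker. *)
Definition letter := option (A * label).

Variables (Q : finType) (q0 : Q) (dfa : Q -> letter -> Q) (final : Q -> bool).
Variables (bit : letter -> option bool) (starter sep : letter -> bool).
Variable related : letter -> letter -> bool -> option bool -> bool.
Hypothesis starter_bit : forall x, starter x -> bit x = None.

Fixpoint block (z : seq letter) : seq bool :=
  if z is x :: z' then if bit x is Some b then b :: block z' else [::] else [::].

(* A starter, the numeral after it, and the number of separators up to it. *)
Definition token := (letter * seq bool * nat)%type.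

Fixpoint tokens (cl : nat) (z : seq letter) : seq token :=
  if z is x :: z' then
    let cl' := cl + sep x in
    if starter x then (x, block z', cl') :: tokens cl' z' else tokens cl' z'
  else [::].

Definition tokrel (t u : token) : bool :=
  related t.1.1 u.1.1 (t.2 == u.2) (compare_bits None t.1.2 u.1.2).

(** The conditions that the machine can test: a finite automaton, and a relation on pairs of
    starters that sees how their numerals compare and whether their separator counts agree. *)
Definition check (z : seq letter) : bool :=
  final (foldl dfa q0 z) && pairwise tokrel (tokens 0 z).

(** The [Q] is the automaton state at head 1, the [bool] tells that no separator was met since head
    1, the [option bool] is the comparison so far. [PBack] undoes a scan; [PReturn] brings head 2
    back towards head 1. *)
Inductive phase :=
  | PInit | PCopy | PRewindCopy | PLabel | PRewindLabel
  | POuter of Q | PInner of Q & bool | PScan of Q & bool & option bool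
  | PBack of Q & bool & option bool | PReturn of Q | PAdvance of Q | PHalt of bool.

Definition phase_code : finType :=
  ('I_5 + Q + Q * bool + Q * bool * option bool + Q * bool * option bool + Q + Q + bool)%type.

Definition code_of_phase (p : phase) : phase_code :=
  match p with
  | PInit => inl (inl (inl (inl (inl (inl (inl (inord 0)))))))
  | PCopy => inl (inl (inl (inl (inl (inl (inl (inord 1)))))))
  | PRewindCopy => inl (inl (inl (inl (inl (inl (inl (inord 2)))))))
  | PLabel => inl (inl (inl (inl (inl (inl (inl (inord 3)))))))
  | PRewindLabel => inl (inl (inl (inl (inl (inl (inl (inord 4)))))))
  | POuter q => inl (inl (inl (inl (inl (inl (inr q))))))
  | PInner q s => inl (inl (inl (inl (inl (inr (q, s))))))
  | PScan q s c => inl (inl (inl (inl (inr (q, s, c)))))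
  | PBack q s c => inl (inl (inl (inr (q, s, c))))
  | PReturn q => inl (inl (inr q))
  | PAdvance q => inl (inr q)
  | PHalt b => inr b
  end.

Definition phase_of_code (p : phase_code) : phase :=
  match p with
  | inl (inl (inl (inl (inl (inl (inl i)))))) =>
      nth PInit [:: PInit; PCopy; PRewindCopy; PLabel; PRewindLabel] i
  | inl (inl (inl (inl (inl (inl (inr q)))))) => POuter q
  | inl (inl (inl (inl (inl (inr (q, s)))))) => PInner q s
  | inl (inl (inl (inl (inr (q, s, c))))) => PScan q s c
  | inl (inl (inl (inr (q, s, c)))) => PBack q s c
  | inl (inl (inr q)) => PReturn q
  | inl (inr q) => PAdvance q
  | inr b => PHalt b
  end.

Lemma code_of_phaseK : cancel code_of_phase phase_of_code.
Proof. by case=> //=; rewrite inordK. Qed.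

HB.instance Definition _ := Finite.copy phase (can_type code_of_phaseK).

Notation cell := (option ((A + bool) + letter)).

Definition ewrite (x : letter) : cell := Some (inr x).
Definition eread (c : cell) : option letter :=
  if c is Some (inr x) then Some x else None.

(** Past the last label [inord] wraps to [ord0], so every certificate yields a labelling. *)
Definition next_label (x : A * label) : A * label := (x.1, inord x.2.+1).

(* Tape 0 is read once from left to right.  Tapes 1 and 2 hold copies of the
   annotated word; for each position of head 1, head 2 sweeps the letters after it
   and the numerals of each pair of starters are compared. *)
Definition transition (p : phase) (a0 a1 a2 : cell) :
    phase * (cell * move) * (cell * move) * (cell * move) :=
  match p with
  | PInit => (PCopy, (a0, MoveN), (ewrite None, MoveR), (ewrite None, MoveR))
  | PCopy =>
      if a0 is Some (inl (inl a)) then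
        let x := ewrite (Some (a, ord0)) in (PCopy, (a0, MoveR), (x, MoveR), (x, MoveR))
      else (PRewindCopy, (a0, MoveN), (a1, MoveN), (a2, MoveN))
  | PRewindCopy =>
      if eread a1 is Some None then (PLabel, (a0, MoveN), (a1, MoveR), (a2, MoveR))
      else (PRewindCopy, (a0, MoveN), (a1, MoveL), (a2, MoveL))
  | PLabel =>
      match eread a1, a0 with
      | Some x, Some (inl (inr true)) =>
          (PLabel, (a0, MoveR), (ewrite (omap next_label x), MoveN), (ewrite (omap next_label x), MoveN))
      | Some _, Some _ => (PLabel, (a0, MoveR), (a1, MoveR), (a2, MoveR))
      | _, _ => (PRewindLabel, (a0, MoveN), (a1, MoveN), (a2, MoveN))
      end
  | PRewindLabel =>
      if eread a1 is Some None then (POuter q0, (a0, MoveN), (a1, MoveN), (a2, MoveN))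
      else (PRewindLabel, (a0, MoveN), (a1, MoveL), (a2, MoveL))
  | POuter q =>
      if eread a1 is Some x then (PInner (dfa q x) true, (a0, MoveN), (a1, MoveN), (a2, MoveR))
      else (PHalt (final q), (a0, MoveN), (a1, MoveN), (a2, MoveN))
  | PInner q s =>
      match eread a1, eread a2 with
      | Some x, Some y =>
          let s' := s && ~~ sep y in
          if starter x && starter y then (PScan q s' None, (a0, MoveN), (a1, MoveR), (a2, MoveR))
          else (PInner q s', (a0, MoveN), (a1, MoveN), (a2, MoveR))
      | _, _ => (PReturn q, (a0, MoveN), (a1, MoveN), (a2, MoveL))
      end
  | PScan q s c =>
      match obind bit (eread a1), obind bit (eread a2) with
      | Some b1, Some b2 =>
          (PScan q s (if b1 == b2 then c else Some b1), (a0, MoveN), (a1, MoveR), (a2, MoveR))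
      | Some _, None => (PBack q s (Some true), (a0, MoveN), (a1, MoveL), (a2, MoveL))
      | None, Some _ => (PBack q s (Some false), (a0, MoveN), (a1, MoveL), (a2, MoveL))
      | None, None => (PBack q s c, (a0, MoveN), (a1, MoveL), (a2, MoveL))
      end
  | PBack q s c =>
      match eread a1, eread a2 with
      | Some x, Some y =>
          if bit x is Some _ then (PBack q s c, (a0, MoveN), (a1, MoveL), (a2, MoveL))
          else if related x y s c then (PInner q s, (a0, MoveN), (a1, MoveN), (a2, MoveR))
          else (PHalt false, (a0, MoveN), (a1, MoveN), (a2, MoveN))
      | _, _ => (PHalt false, (a0, MoveN), (a1, MoveN), (a2, MoveN))
      end
  | PReturn q =>
      if eread a2 is Some _ then (PReturn q, (a0, MoveN), (a1, MoveN), (a2, MoveL))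
      else (PAdvance q, (a0, MoveN), (a1, MoveN), (a2, MoveR))
  (* Erasing the cell left behind makes the next [PReturn] stop at the right place. *)
  | PAdvance q => (POuter q, (a0, MoveN), (a1, MoveR), (None, MoveR))
  | PHalt b => (PHalt b, (a0, MoveN), (a1, MoveN), (a2, MoveN))
  end.

Definition triple (T : Type) (a b c : T) : {ffun 'I_3 -> T} :=
  [ffun i : 'I_3 => if i == 0 :> nat then a else if i == 1 :> nat then b else c].

Definition machine : TM (A + bool)%type := {|
  extra_tapes := 2;
  work := letter;
  state := phase;
  start := PInit;
  verdict := fun p => if p is PHalt b then Some b else None;
  delta := fun p f =>
    let: (q, m0, m1, m2) :=
      transition p (f (@Ordinal 3 0 isT)) (f (@Ordinal 3 1 isT)) (f (@Ordinal 3 2 isT)) in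
    (q, triple m0 m1 m2)
|}.

Notation mtape := (tape ((A + bool) + letter)).

Definition conf (p : phase) (t0 t1 t2 : mtape) : config machine :=
  @Config _ machine p (triple t0 t1 t2).

Lemma step_conf p t0 t1 t2 : (if p is PHalt _ then false else true) ->
  step (conf p t0 t1 t2) =
  let: (q, m0, m1, m2) := transition p (scanned t0) (scanned t1) (scanned t2) in
  conf q (write_move t0 m0) (write_move t1 m1) (write_move t2 m2).
Proof.
move=> np; rewrite /step /conf /=.
have -> : (if p is PHalt b then Some b else None) = None by case: p np.
rewrite /= !ffunE /=.
case: transition => [[[q m0] m1] m2]; congr Config; apply/ffunP=> i.
by rewrite !ffunE; case: ifP => // _; case: ifP.
Qed.

Definition reach (c : config machine) (T : nat) (c' : config machine) : Prop :=
  exists2 t, t <= T & iter t (@step _ machine) c = c'.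

Lemma reach0 c : reach c 0 c. Proof. by exists 0. Qed.

Lemma reach_step c T c' : reach (step c) T c' -> reach c T.+1 c'.
Proof. by case=> t le <-; exists t.+1; rewrite // iterSr. Qed.

Lemma reach_trans T T' c c' c'' : reach c T c' -> reach c' T' c'' -> reach c (T + T') c''.
Proof.
move=> [t le <-] [t' le' <-]; exists (t' + t); last by rewrite iterD.
by rewrite addnC leq_add.
Qed.

Lemma reach_weaken T T' c c' : T <= T' -> reach c T c' -> reach c T' c'.
Proof. by move=> le [t le' e]; exists t => //; apply: leq_trans le' le. Qed.

Definition cells (w : seq letter) : seq cell := rcons (map ewrite w) None.

(** The blank after the word stays explicit, since a head that visited it and moved left leaves it
    in the list. Head 0 never moves left, so [at_input] lists the word alone. *)
Definition at_word (l : seq cell) (w : seq letter) : mtape :=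
  Tape l (head None (cells w)) (behead (cells w)).

Definition at_input (l : seq cell) (w : seq (A + bool)) : mtape :=
  let c := map (fun x => Some (inl x)) w in Tape l (head None c) (behead c).

Lemma write_stay t : write_move t (scanned t, MoveN) = t :> mtape.
Proof. by case: t. Qed.

Lemma scan_blocks q s c t0 x1 x2 l1 l2 r1 r2 :
  reach (conf (PScan q s c) t0 (at_word (ewrite x1 :: l1) r1) (at_word (ewrite x2 :: l2) r2))
    (size r1).*2.+1
    (conf (PBack q s (compare_bits c (block r1) (block r2))) t0 (at_word l1 (x1 :: r1)) (at_word l2 (x2 :: r2))).
Proof.
elim: r1 r2 x1 x2 l1 l2 c => [|y1 r1 IH] [|y2 r2] x1 x2 l1 l2 c; apply: reach_step;
  rewrite step_conf //=.
- by rewrite write_stay; apply: reach0.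
- by case: (bit y2) => [b|]; rewrite /= write_stay; apply: reach0.
- by case: (bit y1) => [b|]; rewrite /= write_stay; apply: reach_weaken (reach0 _).
case b1: (bit y1) => [d1|]; case b2: (bit y2) => [d2|] /=; rewrite write_stay;
  try by apply: reach_weaken (reach0 _).
rewrite doubleS; apply: reach_weaken (reach_trans (IH r2 y1 y2 _ _ _) _); last first.
  by apply: reach_step; rewrite step_conf //= b1 /= write_stay; apply: reach0.
by rewrite addn1.
Qed.

(** The count [cl'] never decreases from [cl], so a flag that falls at the first separator decides
    [cl == cl']. A pair of starters costs at most [2 * N + 3] steps: a scan out and back, and a
    test. *)
Lemma inner_loop t0 l l' x r z q s cl cl' N :
  size r <= N -> size z <= size r -> cl <= cl' -> s = (cl == cl') ->
  let c := conf (PInner q s) t0 (at_word l (x :: r)) (at_word l' z) in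
  if starter x ==> all (tokrel (x, block r, cl)) (tokens cl' z) then
    exists s', reach c (size z * (2 * N + 3))
      (conf (PInner q s') t0 (at_word l (x :: r)) (at_word (rev (map ewrite z) ++ l') [::]))
  else exists c', reach c (size z * (2 * N + 3)) c' /\ cstate c' = PHalt false.
Proof.
move=> leN; elim: z l' s cl' => [|y z IH] l' s cl' /= szz lecl sE.
  by rewrite implybT; exists s; apply: reach0.
have lecl' : cl <= cl' + sep y by rewrite (leq_trans lecl) ?leq_addr.
have s'E : s && ~~ sep y = (cl == cl' + sep y).
  rewrite sE; case: (sep y); rewrite ?andbT ?andbF ?addn0 // addn1.
  by apply/esym/negbTE; rewrite ltn_eqF // ltnS.
have {}IH := IH (ewrite y :: l') _ _ (ltnW szz) lecl' s'E.
rewrite -cat_rcons -rev_cons in IH.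
set c := conf _ _ _ _.
have [sxy|sxy] := boolP (starter x && starter y); last first.
  have -> : starter x ==> all (tokrel (x, block r, cl))
      (if starter y then (y, block z, cl' + sep y) :: tokens (cl' + sep y) z
       else tokens (cl' + sep y) z) =
    (starter x ==> all (tokrel (x, block r, cl)) (tokens (cl' + sep y) z)).
    by move: sxy; case: (starter x) => //= /negbTE->.
  have cE : step c = conf (PInner q (s && ~~ sep y)) t0 (at_word l (x :: r)) (at_word (ewrite y :: l') z).
    by rewrite step_conf //= (negbTE sxy) /= write_stay.
  case: ifP IH => _ [d].
    move=> h; exists d; apply: reach_weaken (reach_step _); last by rewrite cE; apply: h.
    by rewrite mulSn; lia.
  case=> h hd; exists d; split=> //; apply: reach_weaken (reach_step _); last by rewrite cE; apply: h.
  by rewrite mulSn; lia.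
have [sx sy] := andP sxy; rewrite sx sy /= in IH *.
have h1 : reach c (size r).*2.+2 (conf (PBack q (s && ~~ sep y)
    (compare_bits None (block r) (block z))) t0 (at_word l (x :: r)) (at_word l' (y :: z))).
  apply: reach_step; rewrite step_conf //= sx sy /= write_stay.
  by apply: scan_blocks.
have := step_conf (p := PBack q (s && ~~ sep y) (compare_bits None (block r) (block z)))
  t0 (at_word l (x :: r)) (at_word l' (y :: z)) isT.
rewrite /= starter_bit // s'E /tokrel /=.
case: ifP => rel /= h2; last first.
  eexists; split; first apply: reach_weaken (reach_trans h1 (reach_step (reach0 _))).
    by rewrite mulSn -addnn; lia.
  by rewrite s'E h2.
move: IH; rewrite -/(tokrel _) /tokrel.
case: ifP => _ [d].
  move=> h; exists d; apply: reach_weaken (reach_trans h1 (reach_step _)); last first.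
    by rewrite s'E h2 write_stay -s'E; apply: h.
  by rewrite mulSn -addnn; lia.
case=> h hd; exists d; split=> //; apply: reach_weaken (reach_trans h1 (reach_step _)); last first.
  by rewrite s'E h2 write_stay -s'E; apply: h.
by rewrite mulSn -addnn; lia.
Qed.

(** Head 2 walks left to the first blank, which is just before [v]: either the blank beyond the left
    end or the cell erased by the last [PAdvance]. *)
Lemma return_loop t0 t1 q v w l2 : head None l2 = None ->
  reach (conf (PReturn q) t0 t1 (Tape (behead (rev (map ewrite v) ++ l2))
      (head None (rev (map ewrite v) ++ l2)) (cells w))) (size v).+1
    (conf (PAdvance q) t0 t1 (at_word (None :: behead l2) (v ++ w))).
Proof.
move=> l20; elim/last_ind: v w => [|v y IH] w /=.
  by apply: reach_step; rewrite step_conf //= l20 /= !write_stay; case: t1 => *; apply: reach0.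
rewrite map_rcons rev_rcons /= size_rcons; apply: reach_step; rewrite step_conf //= !write_stay.
rewrite cat_rcons; exact: (IH (y :: w)).
Qed.

Definition outer_time N := N * (2 * N + 3) + N + 4.

Lemma outer_loop t0 l l2 z q cl N : size z <= N -> head None l2 = None ->
  exists c', reach (conf (POuter q) t0 (at_word l z) (at_word l2 z)) (size z * outer_time N + 1) c' /\
    cstate c' = PHalt (final (foldl dfa q z) && pairwise tokrel (tokens cl z)).
Proof.
elim: z q l l2 cl => [|x z IH] q l l2 cl szz l20.
  eexists; split; first by apply: reach_step; apply: reach0.
  by rewrite step_conf //= andbT.
set c := conf _ _ _ _ => /=.
have step1 : step c = conf (PInner (dfa q x) true) t0 (at_word l (x :: z)) (at_word (ewrite x :: l2) z).
  by rewrite step_conf //= write_stay.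
have := inner_loop t0 l (ewrite x :: l2) x (dfa q x) (ltnW szz) (leqnn _) (leqnn (cl + sep x)) (esym (eqxx _)).
have -> : pairwise tokrel (if starter x then (x, block z, cl + sep x) :: tokens (cl + sep x) z
    else tokens (cl + sep x) z) =
  (starter x ==> all (tokrel (x, block z, cl + sep x)) (tokens (cl + sep x) z)) &&
  pairwise tokrel (tokens (cl + sep x) z).
  by case: (starter x).
rewrite /=; case: ifP => _ [d]; last first.
  case=> h hd; exists d; split; last by rewrite andbF.
  apply: reach_weaken (reach_step _); last by rewrite step1; apply: h.
  by rewrite /outer_time; nia.
move=> h.
(* On tape 2 the first [None] is the cell just erased, the second the blank where [PReturn]
   stopped. *)
have [c' [h' hc']] := IH (dfa q x) (ewrite x :: l) (None :: None :: behead l2) (cl + sep x) (ltnW szz) erefl.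
exists c'; split=> //.
have ret := return_loop t0 (at_word l (x :: z)) (dfa q x) (x :: z) [::] l20.
have revE : rev [seq ewrite i | i <- z] ++ ewrite x :: l2 = rev [seq ewrite i | i <- x :: z] ++ l2.
  by rewrite -cat_rcons -rev_cons.
have tail : reach (conf (PAdvance (dfa q x)) t0 (at_word l (x :: z))
    (at_word (None :: behead l2) ((x :: z) ++ [::]))) (size z * outer_time N + 1).+1 c'.
  by apply: reach_step; rewrite cats0 step_conf //= write_stay.
have h2 := reach_trans ret tail.
have h3 : reach c ((size z * (2 * N + 3)) + ((size z).+2 + (size z * outer_time N + 1).+1).+1).+1 c'.
  apply: reach_step; rewrite step1; apply: reach_trans h (reach_step _).
  by rewrite step_conf //= !write_stay revE; apply: h2.
apply: reach_weaken h3.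
by move: szz; rewrite /= /outer_time; nia.
Qed.

(** The machine must be described on every word over [A + bool]: all that follows the first [inr]
    counts as certificate, and a stray [inl] in it acts like [false]. *)
Fixpoint input_of (w : seq (A + bool)) : seq A :=
  if w is inl a :: w' then a :: input_of w' else [::].

Fixpoint certificate_of (w : seq (A + bool)) : seq (A + bool) :=
  if w is inl _ :: w' then certificate_of w' else w.

(* In a certificate, [true] increments the current label and [false] moves on to
   the next letter. *)
Fixpoint relabel (u : seq (A + bool)) (z : seq (A * label)) : seq (A * label) :=
  match z, u with
  | [::], _ => [::]
  | _, [::] => z
  | x :: z', inr true :: u' => relabel u' (next_label x :: z')
  | x :: z', _ :: u' => x :: relabel u' z'
  end.

Definition annotated (w : seq (A + bool)) : seq letter :=
  None :: map Some (relabel (certificate_of w) [seq (a, ord0) | a <- input_of w]).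

Lemma copy_loop l0 l w : exists l0',
  reach (conf PCopy (at_input l0 w) (Tape l None [::]) (Tape l None [::])) (size w).+1
    (let t := Tape (rev [seq ewrite (Some (a, ord0)) | a <- input_of w] ++ l) None [::] in
     conf PRewindCopy (at_input l0' (certificate_of w)) t t).
Proof.
elim: w l0 l => [|[a|b] w IH] l0 l /=.
- by exists l0; apply: reach_step; rewrite step_conf //= ?write_stay; apply: reach0.
- have [l0' h] := IH (Some (inl (inl a)) :: l0) (ewrite (Some (a, ord0)) :: l).
  exists l0'; apply: reach_step; rewrite step_conf //= rev_cons cat_rcons; exact: h.
- exists l0; apply: reach_step; rewrite step_conf //=; apply: reach_weaken (reach0 _).
  by [].
Qed.

Lemma rewind_loop p t0 (u : seq (A * label)) c r :
  p = PRewindCopy \/ p = PRewindLabel -> eread c <> Some None ->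
  let t := Tape (rev (map (ewrite \o Some) u) ++ [:: ewrite None]) c r in
  let t' := Tape [::] (ewrite None) (map (ewrite \o Some) u ++ c :: r) in
  reach (conf p t0 t t) (size u).+1 (conf p t0 t' t').
Proof.
move=> pE; elim/last_ind: u c r => [|u x IH] c r cN /=.
  apply: reach_step; rewrite step_conf; last by case: pE => ->.
  case: pE => -> /=; case E: (eread c) cN => [[x|]|] // _; rewrite ?write_stay; apply: reach0.
rewrite map_rcons rev_rcons /= size_rcons cat_rcons; apply: reach_step.
rewrite step_conf; last by case: pE => ->.
have {}IH := IH (ewrite (Some x)) (c :: r).
case: pE IH => -> /= IH; case E: (eread c) cN => [[y|]|] // _; rewrite ?write_stay; exact: IH.
Qed.

Lemma label_loop l0 u z v : exists l0' v' z', v' ++ z' = v ++ relabel u z /\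
  reach (conf PLabel (at_input l0 u) 
     (at_word (rev (map (ewrite \o Some) v) ++ [:: ewrite None]) (map Some z))
     (at_word (rev (map (ewrite \o Some) v) ++ [:: ewrite None]) (map Some z))) (size u).+1
   (conf PRewindLabel l0'
     (at_word (rev (map (ewrite \o Some) v') ++ [:: ewrite None]) (map Some z'))
     (at_word (rev (map (ewrite \o Some) v') ++ [:: ewrite None]) (map Some z'))).
Proof.
have stop l w y (v1 : seq (A * label)) : (w == [::]) || (y == [::]) -> exists l0' v' z', v' ++ z' = v1 ++ y /\
  reach (conf PLabel (at_input l w)
     (at_word (rev (map (ewrite \o Some) v1) ++ [:: ewrite None]) (map Some y))
     (at_word (rev (map (ewrite \o Some) v1) ++ [:: ewrite None]) (map Some y))) (size w).+1
   (conf PRewindLabel l0'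
     (at_word (rev (map (ewrite \o Some) v') ++ [:: ewrite None]) (map Some z'))
     (at_word (rev (map (ewrite \o Some) v') ++ [:: ewrite None]) (map Some z'))).
  move=> wy; exists (at_input l w), v1, y; split=> //; apply: (@reach_weaken 1) => //; apply: reach_step.
  by rewrite step_conf //=; case: w wy => [|b w]; case: y => [|x y] //= _; apply: reach0.
elim: u l0 z v => [|b u IH] l0 [|x z] v.
- exact: (stop l0 [::] [::]).
- exact: (stop l0 [::] (x :: z)).
- exact: (stop l0 (b :: u) [::]).
have [be|bne] : b = inr true \/ b <> inr true.
  by case: b => [a|[]]; try (by right); left.
  have [l0' [v' [z' [e h]]]] := IH (Some (inl b) :: l0) (next_label x :: z) v.
  exists l0', v', z'; rewrite be /=; split=> //.
  by apply: reach_step; rewrite step_conf //= -be; exact: h.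
have [l0' [v' [z' [e h]]]] := IH (Some (inl b) :: l0) z (rcons v x).
exists l0', v', z'; split.
  by rewrite e cat_rcons; case: b bne {h e} => [a|[]].
apply: reach_step; rewrite step_conf //=.
rewrite map_rcons rev_rcons /= in h.
case: b bne h {e} => [a|[]] // _ h; rewrite /= ?write_stay; exact: h.
Qed.

Lemma size_relabel u z : size (relabel u z) = size z.
Proof.
elim: u z => [|b u IH] [|x z] //; case: b => [a|[]]; rewrite ?IH //= IH //.
Qed.

Lemma size_annotated w : size (annotated w) <= (size w).+1.
Proof.
rewrite /= size_map size_relabel size_map ltnS.
by elim: w => [|[a|b] w IH].
Qed.

Lemma size_certificate w : size (certificate_of w) <= size w.
Proof. by elim: w => [|[a|b] w IH] //=; apply: leqW. Qed.

Definition run_time n := 4 * n + 12 + n.+1 * outer_time n.+1.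

Lemma machine_run w : exists c', reach (init machine w) (run_time (size w)) c' /\
  cstate c' = PHalt (check (annotated w)).
Proof.
have initE : init machine w = conf PInit (at_input [::] w) (Tape [::] None [::]) (Tape [::] None [::]).
  congr Config; apply/ffunP=> i; rewrite !ffunE.
  by case: i => [[|[|[]]]] //= _; rewrite /tape_of_seq /at_input -?map_comp.
rewrite initE; have [l0 h1] := copy_loop [::] [:: ewrite None] w.
pose u := [seq (a, ord0 : label) | a <- input_of w].
have szu : size u <= size w by rewrite size_map; elim: w {initE h1 u} => [|[a|b] w IH].
have uE : [seq ewrite (Some (a, ord0)) | a <- input_of w] = map (ewrite \o Some) u.
  by rewrite -map_comp.
rewrite uE /= in h1.
have h2 := @rewind_loop PRewindCopy (at_input l0 (certificate_of w)) u None [::]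
  (or_introl erefl) (fun e => ltac:(discriminate e)).
have [l0' [v' [z' [e h3]]]] := label_loop l0 (certificate_of w) u [::].
have cN : eread (head None (cells (map Some z'))) <> Some None by case: z' {e h3}.
have h4 := rewind_loop l0' v' (behead (cells (map Some z'))) (or_intror erefl) cN.
have sz : size (annotated w) <= (size w).+1 by apply: size_annotated.
have [c' [h5 c'E]] := outer_loop l0' [::] (l2 := [::]) q0 0 sz erefl.
exists c'; split=> //.
have szv : size v' <= size w.
  have := congr1 size e; rewrite size_cat size_relabel => e'.
  by apply: leq_trans szu; rewrite -e' leq_addr.
have annE : annotated w = None :: map Some (v' ++ z') by rewrite e.
have h45 : reach (conf PRewindLabel l0'
     (at_word (rev (map (ewrite \o Some) v') ++ [:: ewrite None]) (map Some z'))
     (at_word (rev (map (ewrite \o Some) v') ++ [:: ewrite None]) (map Some z')))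
    ((size v').+1 + (size (annotated w) * outer_time (size w).+1 + 1).+1) c'.
  apply: reach_trans h4 (reach_step _); rewrite step_conf //= !write_stay.
  move: (_ * _) h5 => T; rewrite annE /at_word /cells /= !map_cat rcons_cat -map_comp.
  by case: z' {e h3 cN annE} => [|x z'] /=.
have h35 := reach_trans h3 h45.
have h25 : reach (conf PRewindCopy (at_input l0 (certificate_of w))
    (Tape (rev (map (ewrite \o Some) u) ++ [:: ewrite None]) None [::])
    (Tape (rev (map (ewrite \o Some) u) ++ [:: ewrite None]) None [::]))
    ((size u).+1 + ((size (certificate_of w)).+1 +
      ((size v').+1 + (size (annotated w) * outer_time (size w).+1 + 1).+1)).+1) c'.
  apply: reach_trans h2 (reach_step _); rewrite step_conf //= ?write_stay.
  move: h35; rewrite /at_word /cells -map_comp.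
  by case: (u) => [|x u'] /=; rewrite ?cats1.
have h15 := reach_trans h1 h25.
apply: reach_weaken (reach_step _); last by rewrite step_conf //= ?write_stay; exact: h15.
have le : size (annotated w) * outer_time (size w).+1 <= (size w).+1 * outer_time (size w).+1.
  by rewrite leq_mul2r sz orbT.
have szc := size_certificate w.
rewrite /run_time; move: (size (annotated w) * _) ((size w).+1 * _) le => X Y le.
move: (size u) (size v') (size (certificate_of w)) (size w) szu szv szc => a b c d; clear -le; lia.
Qed.

Definition accepted : language (A + bool)%type := fun w => check (annotated w).

Lemma accepted_in_P : in_P accepted.
Proof.
(* [run_time] is cubic and generously bounded; a halted machine keeps its verdict, so halting early
   suffices. *)
exists machine, ((20 *: ('X + 3%:R%:P) ^+ 3)%R : {poly nat}) => w.
have [c' [[t le tE] c'E]] := machine_run w.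
exists (check (annotated w)) => //.
have leT : t <= (20 *: ('X + 3%:R%:P) ^+ 3 : {poly nat}).[size w]%R.
  apply: leq_trans le _; rewrite hornerZ horner_exp hornerD hornerX hornerC.
  rewrite /run_time /outer_time; set n := size w.
  have -> : (20 * (n + 3%:R) ^+ 3)%R = 20 * (n + 3) ^ 3 by rewrite -natrXE.
  by rewrite !expnS expn0; lia.
by rewrite /answer_at -(subnK leT) iterD tE; apply: verdict_iter; rewrite c'E.
Qed.

Definition encode_labels (s : seq label) : seq bool :=
  flatten [seq rcons (nseq i true) false | i : label <- s].

Lemma relabel_encode x s : size s = size x ->
  relabel (map inr (encode_labels s)) [seq (a, ord0) | a <- x] = zip x s.
Proof.
elim: x s => [|a x IH] [|i s] //= [szs].
suff h j : i + j <= J -> forall t,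
    relabel (map inr (rcons (nseq i true) false ++ t)) ((a, inord j) :: [seq (a, ord0) | a <- x]) =
    (a, inord (i + j)) :: relabel (map inr t) [seq (a, ord0) | a <- x].
  have := h 0; rewrite addn0 -ltnS ltn_ord => /(_ isT (encode_labels s)).
  have -> : inord 0 = ord0 :> label by apply: val_inj; rewrite /= inordK.
  by rewrite inord_val IH // => <-.
elim: (nat_of_ord i) j => [|m IHm] j ij t //=.
rewrite /next_label /= inordK; last by rewrite ltnS (leq_trans _ ij) // leq_addl.
by rewrite IHm -addSnnS.
Qed.

Lemma size_encode_labels s : size (encode_labels s) <= J.+1 * size s.
Proof.
elim: s => //= i s IH; rewrite size_cat size_rcons size_nseq mulnS.
by rewrite leq_add // ltn_ord.
Qed.

(** For soundness: any certificate makes the machine check some labelling of the input. *)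
Lemma relabel_zip u x : exists2 s : seq label, size s = size x &
  relabel u [seq (a, ord0) | a <- x] = zip x s.
Proof.
have h z : exists2 s : seq label, size s = size z & relabel u z = zip (map fst z) s.
  elim: u z => [|b u IH] [|[a i] z]; try by exists [::].
    by exists (unzip2 ((a, i) :: z)); rewrite ?size_map // -/(unzip1 _) zip_unzip.
  have shift : exists2 s : seq label, size s = (size z).+1 &
      (a, i) :: relabel u z = zip (a :: map fst z) s.
    by have [s szs e] := IH z; exists (i :: s); rewrite /= ?szs ?e.
  case: b => [c|[]] //=; have [s szs e] := IH (next_label (a, i) :: z).
  by exists s; rewrite ?szs.
have [s szs e] := h [seq (a, ord0) | a <- x]; exists s; first by rewrite szs size_map.
by rewrite e -map_comp map_id.
Qed.

Lemma annotated_check_in_NP (L : language A) :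
  (forall x, L x <-> exists2 s : seq label, size s = size x &
     check (None :: map Some (zip x s))) -> in_NP L.
Proof.
move=> LP; exists accepted, ((J.+1 *: 'X)%R : {poly nat}); split; first exact: accepted_in_P.
have annE x u : annotated (map inl x ++ map inr u) =
    None :: map Some (relabel (map inr u) [seq (a, ord0) | a <- x]).
  rewrite /annotated; have -> : certificate_of (map inl x ++ map inr u) = map inr u.
    by elim: x => //=; case: u.
  by have -> : input_of (map inl x ++ map inr u) = x by elim: x => [|a x /= ->] //; case: u.
move=> x; rewrite LP; split=> [[s szs chk]|[u _]].
  exists (encode_labels s).
    by rewrite hornerZ hornerX; apply: leq_trans (size_encode_labels s) _; rewrite szs.
  by rewrite /accepted annE relabel_encode.
rewrite /accepted annE; have [s szs ->] := relabel_zip (map inr u) x.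
by exists s.
Qed.

End Machine.

(** * Certificates *)

Section Selection.
Variables (n V : nat) (y : 'I_V -> option 'I_n).
Hypothesis y_inj : forall i j v, y i = Some v -> y j = Some v -> i = j.

Definition select (b : assignment n) (e : {ffun 'I_V -> bool}) : {ffun 'I_V -> bool} :=
  [ffun j => if y j is Some v then b v else e j].

(** The value of each variable [y j] is swapped with the entry [j] of the vector, which makes the
    selection the second component of a pair. *)
Definition exchange (p : assignment n * {ffun 'I_V -> bool}) :=
  ([ffun v => if [pick j | y j == Some v] is Some j then p.2 j else p.1 v] : assignment n,
   select p.1 p.2).

Lemma exchangeK : involutive exchange.
Proof.
case=> b e; rewrite /exchange /=; congr (_, _); apply/ffunP => i; rewrite !ffunE.
  by case: pickP => [j /eqP yj|//]; rewrite ffunE yj.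
case yi: (y i) => [v|//]; rewrite ffunE; case: pickP => [j /eqP yj|/(_ i)].
  by rewrite (y_inj yj yi).
by rewrite yi eqxx.
Qed.

(** By the involution [exchange], [G] has the same density among vectors as its preimage among
    pairs. Indices without a variable are filled from the vector, so the number of indices in use
    does not enter. *)
Lemma card_select (G : {set {ffun 'I_V -> bool}}) :
  #|[set p : assignment n * {ffun 'I_V -> bool} | select p.1 p.2 \in G]| = 2 ^ n * #|G|.
Proof.
have -> : [set p | select p.1 p.2 \in G] = exchange @^-1: (setX [set: assignment n] G).
  by apply/setP=> p; rewrite !inE.
rewrite on_card_preimset; last by apply: onW_bij; apply: inv_bij exchangeK.
by rewrite cardsX cardsT card_ffun card_bool card_ord.
Qed.

End Selection.

Lemma card_pred_fst (T U : finType) (P : pred T) :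
  #|[set p : T * U | P p.1]| = #|[set x | P x]| * #|U|.
Proof. by rewrite -cardsT -cardsX; apply: eq_card => p; rewrite !inE andbT. Qed.

(** * Annotated formulas and the soundness of certificates *)

Section Annotation.
Variables (V : nat) (rho : rat).

(* A variable is possibly one of the [V] branching variables; it has a truth
   value in the satisfying assignment guessed by the certificate; and an occurrence
   is tagged when its variable witnesses that the surrounding clause is a tautology. *)
Definition payload := (option 'I_V * bool * bool)%type.

Definition branch (x : payload) := x.1.1.
Definition guess (x : payload) := x.1.2.
Definition tagged_taut (x : payload) := x.2.

Definition branch_true (a : {ffun 'I_V -> bool}) (s : bool) (x : payload) : bool :=
  if branch x is Some j then a j == s else false.

Definition guess_true (s : bool) (x : payload) : bool := guess x == s.

Definition clause_ok (tr : bool -> payload -> bool) (c : seq (bool * payload)) : bool :=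
  has (fun o => tr o.1 o.2) c ||
  has (fun o => tagged_taut o.2 && o.1) c && has (fun o => tagged_taut o.2 && ~~ o.1) c.

Definition good_branches (Psi : seq (seq (bool * payload))) : {set {ffun 'I_V -> bool}} :=
  [set a | all (clause_ok (branch_true a)) Psi].

Definition guess_agrees (a : {ffun 'I_V -> bool}) (x : payload) : bool :=
  if branch x is Some j then a j == guess x else true.

(** In the second case the guess is one satisfying assignment more: [a] carries its values on the
    branching variables and is not a good branch, so the guess lies outside the core. *)
Definition enough (Psi : seq (seq (bool * payload))) : bool :=
  let g : rat := #|good_branches Psi|%:R%R in
  (rho * 2%:R ^+ V <= g)%R && ((rho * 2%:R ^+ V < g)%R ||
    all (clause_ok guess_true) Psi &&
    [exists a, (a \notin good_branches Psi) && all (fun o => guess_agrees a o.2) (flatten Psi)]).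

(** A variable may lack its index at some occurrences. This is harmless to soundness, since a
    literal without index never counts as true on a branch. *)
Definition compatible (x y : payload) (same_clause same_var : bool) : bool :=
  [&& same_var ==> (guess x == guess y),
      (if branch x is Some i then if branch y is Some j then (i == j) == same_var else true else true)
    & same_clause && tagged_taut x && tagged_taut y ==> same_var].

Section Typed.
Variable n : nat.
Definition occurrence := (literal n * payload)%type.
Implicit Types (o : occurrence) (Psi : seq (seq occurrence)).

Definition signs (c : seq occurrence) : seq (bool * payload) := [seq (o.1.2, o.2) | o <- c].

Definition consistent Psi : Prop :=
  (forall o o', o \in flatten Psi -> o' \in flatten Psi -> compatible o.2 o'.2 false (o.1.1 == o'.1.1)) /\
  (forall c o o', c \in Psi -> o \in c -> o' \in c -> compatible o.2 o'.2 true (o.1.1 == o'.1.1)).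

(** Pairs of an assignment and a vector are counted: those with good selection number
    [2 ^ n * #|G|], those with satisfying assignment [num_sat * 2 ^ V], and the former are among the
    latter. In the tight case the guess paired with [a] makes the inclusion strict. *)
Lemma certificate_sound Psi : consistent Psi -> enough (map signs Psi) ->
  (rho * 2%:R ^+ n < (num_sat (map (map fst) Psi))%:R)%R.
Proof.
case=> cons1 cons2 /andP[geG].
set G := good_branches _ in geG *.
pose occ j v := has (fun o => (branch o.2 == Some j) && (o.1.1 == v)) (flatten Psi).
pose y j := [pick v | occ j v].
have flatP c o : c \in Psi -> o \in c -> o \in flatten Psi.
  by move=> cP oc; apply/flattenP; exists c.
have y_occ o j : o \in flatten Psi -> branch o.2 = Some j -> y j = Some o.1.1.
  move=> oP bo; rewrite /y; case: pickP => [v /hasP[o' o'P /andP[/eqP bo' /eqP <-]]|/(_ o.1.1)].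
    have := cons1 _ _ o'P oP; rewrite /compatible bo bo' eqxx => /and3P[_ /eqP h _].
    by congr Some; apply/eqP.
  by case/hasP; exists o; rewrite // bo !eqxx.
have y_inj i j v : y i = Some v -> y j = Some v -> i = j.
  rewrite /y; case: pickP => // _ /hasP[o oP /andP[/eqP bo /eqP <-]] [<-].
  case: pickP => // _ /hasP[o' o'P /andP[/eqP bo' /eqP <-]] [e].
  have := cons1 _ _ oP o'P; rewrite /compatible bo bo' e eqxx => /and3P[_ /eqP h _].
  by apply/eqP.
have taut_sat c (b : assignment n) : c \in Psi -> has (fun s => tagged_taut s.2 && s.1) (signs c) ->
    has (fun s => tagged_taut s.2 && ~~ s.1) (signs c) ->
    has (fun l : literal n => b l.1 == l.2) (map fst c).
  move=> cP; rewrite !has_map => /hasP[o oc /= /andP[to so]] /hasP[o' o'c /= /andP[to' so']].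
  have := cons2 _ _ _ cP oc o'c; rewrite /compatible to to' => /and3P[_ _ /eqP e].
  case bo: (b o.1.1); apply/hasP; first by exists o; rewrite //= bo so.
  by exists o'; rewrite //= -e bo; case: (o'.1.2) so'.
have sat_select b e : select y b e \in G -> satisfies b (map (map fst) Psi).
  rewrite inE /satisfies !all_map => /allP ok; apply/allP => c cP /=.
  have /orP[|/andP[]] := ok c cP; last exact: taut_sat.
  rewrite !has_map => /hasP[o oc /=]; rewrite /branch_true.
  case bo: (branch o.2) => [j|//]; rewrite ffunE (y_occ _ _ (flatP _ _ cP oc) bo) => ob.
  by apply/hasP; exists o.
have cardL := card_select y_inj G.
have cardR := card_pred_fst {ffun 'I_V -> bool} (fun b => satisfies b (map (map fst) Psi)).
rewrite -/(num_sat _) card_ffun card_bool card_ord in cardR.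
set L := [set p | _] in cardL; set S := [set p | _] in cardR.
have LS : L \subset S by apply/subsetP => p; rewrite [p \in L]inE [p \in S]inE; apply: sat_select.
have two0 m : (0 < 2%:R ^+ m :> rat)%R by rewrite exprn_gt0.
case/orP => [gtG|/andP[okg /existsP[a /andP[aG ag]]]].
  have := subset_leq_card LS; rewrite cardL cardR -(ler_nat rat) !natrM !natrX => le.
  rewrite -(ltr_pM2r (two0 V)); apply: lt_le_trans le.
  by rewrite mulrAC mulrC ltr_pM2l.
have : #|L| < #|S|.
  apply: proper_card; rewrite properE LS; apply/subsetPn.
  pose b : assignment n := [ffun v => has (fun o => (o.1.1 == v) && guess o.2) (flatten Psi)].
  have bE o : o \in flatten Psi -> b o.1.1 = guess o.2.
    move=> oP; rewrite ffunE; apply/hasP/idP => [[o' o'P /andP[/eqP e g]]|g].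
      by have := cons1 _ _ o'P oP; rewrite /compatible e eqxx g => /and3P[/eqP <-].
    by exists o; rewrite // eqxx.
  exists (b, a); rewrite inE /=.
    apply/allP => _ /mapP[c cP ->].
    move: okg; rewrite all_map => /allP/(_ c cP) /orP[|/andP[]]; last exact: taut_sat.
    rewrite !has_map => /hasP[o oc /= ob]; apply/hasP; exists o => //=.
    by rewrite bE // (flatP c).
  apply: contra aG; rewrite !inE !all_map => /allP ok; apply/allP => c cP.
  have := ok c cP; rewrite /= /clause_ok; case: (has _ _ && has _ _); rewrite ?orbT // !orbF.
  rewrite !has_map => /hasP[o oc /=]; rewrite /branch_true.
  case bo: (branch o.2) => [j|//] h; apply/hasP; exists o => //=.
  move: h; rewrite /branch_true bo ffunE (y_occ _ _ (flatP _ _ cP oc) bo) bE ?(flatP c) //.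
  have : (o.1.2, o.2) \in flatten (map signs Psi).
    by apply/flattenP; exists (signs c); rewrite ?map_f //; apply/mapP; exists o.
  by move/(allP ag); rewrite /guess_agrees /= bo => /eqP->.
rewrite cardL cardR -(ltr_nat rat) !natrM !natrX => lt.
rewrite -(ltr_pM2r (two0 V)); apply: le_lt_trans lt.
by rewrite mulrAC mulrC ler_pM2l.
Qed.
End Typed.
End Annotation.

Lemma certificate_complete k (rho : rat) : exists V : nat, forall n (phi : cnf n),
  is_kcnf k phi -> (rho * 2%:R ^+ n < (num_sat phi)%:R)%R ->
  exists Psi : seq (seq (occurrence V n)),
    [/\ map (map fst) Psi = phi, consistent Psi & enough rho (map (@signs V n) Psi)].
Proof.
have [V [eps eps0 bound]] := core_bound_exists k 1 rho.
exists V => n phi kphi gt.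
pose taut (c : clause n) := ~~ all (fun l : literal n => (l.1, ~~ l.2) \notin c) c.
(* The core bound asks for a tautology-free formula; the dropped clauses hold everywhere and are
   certified by tags. *)
pose phi' := [seq c <- phi | ~~ taut c].
have tautP c : taut c -> exists v, ((v, true) \in c) && ((v, false) \in c).
  case/allPn => [[v [|]] lc]; rewrite negbK => lc'; exists v; by rewrite lc lc'.
have satE (b : assignment n) : satisfies b phi' = satisfies b phi.
  rewrite /satisfies all_filter; apply: eq_all => c /=.
  case tc: (taut c) => //=; have [v /andP[vt vf]] := tautP c tc.
  by apply/esym/hasP; case bv: (b v); [exists (v, true) | exists (v, false)]; rewrite //= bv.
have numE : num_sat phi' = num_sat phi.
  by apply: eq_card => b; rewrite !inE satE.
have [|psi||Y szY coreY] := bound n [:: phi'].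
- by [].
- rewrite inE => /eqP->; split; last by rewrite /is_kcnf all_filter; apply: sub_all kphi => c /= ->; rewrite implybT.
  by rewrite /taut_free all_filter; apply/allP => c _; apply/implyP; rewrite negbK.
- rewrite big_seq1 numE; apply: le_lt_trans gt.
  by rewrite ler_wpM2r ?exprn_ge0 // gerBl ltW.
rewrite big_seq1 in coreY.
pose Z := undup Y.
have szZ : size Z <= V by apply: leq_trans (size_undup Y) szY.
(* In the duplicate-free list [Z] the variables of [Y] have distinct positions below [V], so [insub]
   succeeds on them. *)
pose sp v : option 'I_V := if v \in Y then insub (index v Z) else None.
have spN v : v \in Y -> exists j, sp v = Some j.
  move=> vY; rewrite /sp vY; case: insubP => [j _ _|]; first by exists j.
  by rewrite (leq_trans _ szZ) // index_mem mem_undup.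
have sp_inj v w j : sp v = Some j -> sp w = Some j -> v = w.
  rewrite /sp; case: ifP => // vY; case: insubP => // i _ iE [<-].
  case: ifP => // wY; case: insubP => // i' _ iE' [e].
  apply: (@index_inj _ v Z); rewrite ?mem_undup //.
  by rewrite -iE -iE' e.
pose y j := [pick v | sp v == Some j].
have ysp v j : sp v = Some j -> y j = Some v.
  move=> e; rewrite /y; case: pickP => [w /eqP e'|/(_ v)]; last by rewrite e eqxx.
  by rewrite (sp_inj _ _ _ e' e).
have y_sp v j : y j = Some v -> sp v = Some j.
  by rewrite /y; case: pickP => // w /eqP e [<-].
have y_inj i j v : y i = Some v -> y j = Some v -> i = j.
  by move=> /y_sp e /y_sp; rewrite e => -[].
pose vt (c : clause n) := [pick v | ((v, true) \in c) && ((v, false) \in c)].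
pose Psi (be : assignment n) : seq (seq (occurrence V n)) :=
  [seq [seq (l, (sp l.1, be l.1, vt c == Some l.1)) | l : literal n <- c] | c : clause n <- phi].
have PsiE be : map (map fst) (Psi be) = phi.
  by rewrite /Psi -map_comp map_id_in // => c _ /=; rewrite -map_comp map_id.
have consPsi be : consistent (Psi be).
  have sp_eq v w : is_true (if sp v is Some i then if sp w is Some j then (i == j) == (v == w) else true else true).
    case e: (sp v) => [i|//]; case e': (sp w) => [j|//]; apply/eqP.
    apply/eqP/eqP => [ij|vw]; first by apply: (sp_inj _ _ i e); rewrite e' ij.
    by move: e e'; rewrite vw => -> [].
  split=> [o o'|c o o'].
    move=> /flattenP[_ /mapP[c cP ->] /mapP[l lc ->]] /flattenP[_ /mapP[c' cP' ->] /mapP[l' lc' ->]].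
    apply/and3P; split=> //=; last exact: sp_eq.
    by apply/implyP => /eqP->.
  move=> /mapP[d dP ->] /mapP[l lc ->] /mapP[l' lc' ->].
  apply/and3P; split=> //=; last 1 first.
  - by apply/implyP => /andP[/eqP-> /eqP[->]].
  - by apply/implyP => /eqP->.
  - exact: sp_eq.
have tautE be c : has (fun o => tagged_taut o.2 && o.1)
      (signs [seq (l, (sp l.1, be l.1, vt c == Some l.1)) | l : literal n <- c]) &&
    has (fun o => tagged_taut o.2 && ~~ o.1)
      (signs [seq (l, (sp l.1, be l.1, vt c == Some l.1)) | l : literal n <- c]) = taut c.
  rewrite !has_map; apply/andP/idP => [[/hasP[[v s] lc /= /andP[/eqP e st]] /hasP[[w t] lc' /= /andP[e' tf]]]|tc].
    rewrite e in e'; have /eqP[vw] := e'; apply/allPn; exists (v, s) => //.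
    by rewrite negbK /= -vw (_ : ~~ s = t) // in lc' *; case: (s) st; case: (t) tf.
  have : exists v, vt c = Some v /\ ((v, true) \in c) && ((v, false) \in c).
    by rewrite /vt; case: pickP => [v vP|no]; [exists v | have [v] := tautP c tc; rewrite no].
  case=> v [e /andP[vtr vfa]].
  by split; apply/hasP; [exists (v, true) | exists (v, false)]; rewrite //= /tagged_taut /= e eqxx.
pose inCore (b : assignment n) :=
  all (has (fun l : literal n => (l.1 \in Y) && (b l.1 == l.2))) phi'.
have goodE be b e : (select y b e \in good_branches (map (@signs V n) (Psi be))) = inCore b.
  rewrite inE /inCore all_filter !all_map; apply: eq_all => c /=.
  rewrite /clause_ok tautE; case tc: (taut c) => /=; rewrite ?orbT // orbF !has_map.
  apply: eq_has => l /=; rewrite /branch_true /branch /=.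
  case lY: (l.1 \in Y); last by rewrite /sp lY.
  by have [j e'] := spN _ lY; rewrite e' ffunE (ysp _ _ e').
have cardE be : 2 ^ n * #|good_branches (map (@signs V n) (Psi be))| = core (mem Y) phi' * 2 ^ V.
  rewrite -(card_select y_inj).
  have := card_pred_fst {ffun 'I_V -> bool} inCore.
  have -> : core (mem Y) phi' = #|[set b | inCore b]| by rewrite cardsE.
  rewrite card_ffun card_bool card_ord => <-.
  by apply: eq_card => p; rewrite [LHS]inE [RHS]inE goodE.
have two0 m : (0 < 2%:R ^+ m :> rat)%R by rewrite exprn_gt0.
have cardR be : (2%:R ^+ n * #|good_branches (map (@signs V n) (Psi be))|%:R =
    (core (mem Y) phi')%:R * 2%:R ^+ V :> rat)%R.
  by rewrite -!natrX -!natrM cardE.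
have geG be : (rho * 2%:R ^+ V <= #|good_branches (map (@signs V n) (Psi be))|%:R)%R.
  by rewrite -(ler_pM2l (two0 n)) cardR mulrA ler_pM2r // mulrC.
have [lt|ge] := ltP (rho * 2%:R ^+ n)%R (core (mem Y) phi')%:R%R.
  exists (Psi [ffun=> false]); split=> //; rewrite /enough geG /=; apply/orP; left.
  by rewrite -(ltr_pM2l (two0 n)) cardR mulrA ltr_pM2r // mulrC.
(* The core is exactly at the threshold, so some satisfying assignment lies outside it and becomes
   the guess. *)
have : core (mem Y) phi' < num_sat phi by rewrite -(ltr_nat rat) (le_lt_trans ge).
have [/existsP[be /andP[beS beN]] _|/existsPn no] :=
    boolP [exists b : assignment n, satisfies b phi && ~~ inCore b]; last first.
  rewrite ltnNge => /negP[]; apply: subset_leq_card; apply/subsetP => b; rewrite !inE => bS.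
  by have := no b; rewrite bS negbK.
exists (Psi be); split=> //; rewrite /enough geG /=; apply/orP; right; apply/andP; split.
  rewrite !all_map; apply/allP => c cP /=; apply/orP; left; rewrite !has_map.
  by have /hasP[l lc e] := allP beS c cP; apply/hasP; exists l.
apply/existsP; exists (select y be [ffun=> false]); rewrite goodE beN /=.
apply/allP => o /flattenP[_ /mapP[_ /mapP[c cP ->] ->] /mapP[_ /mapP[l lc ->] ->]] /=.
rewrite /guess_agrees /branch /=; case e: (sp l.1) => [j|//].
by rewrite ffunE (ysp _ _ e).
Qed.

(** * The verifier *)

Definition bits_value (s : seq bool) : nat := foldr (fun (b : bool) m => b + m.*2) 0 s.

Lemma bits_of_posP p : bits_value (bits_of_pos p) = nat_of_pos p /\ last false (bits_of_pos p).
Proof.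
elim: p => [p [IH l]|p [IH l]|] //=; rewrite IH NatTrec.doubleE; split=> //.
by case: (bits_of_pos p) l.
Qed.

Lemma bits_value_bits n : bits_value (bits n) = n.
Proof.
rewrite /bits -{2}(bin_of_natK n); case: (bin_of_nat n) => //= p.
by case: (bits_of_posP p).
Qed.

(** [last true] expresses the absence of leading zeros, its default admitting the empty numeral of
    zero. *)
Lemma last_bits n : last true (bits n).
Proof. by rewrite /bits; case: (bin_of_nat n) => //= p; have [_] := bits_of_posP p; case: (bits_of_pos p). Qed.

Lemma bits_surj s : last true s -> exists n, bits n = s.
Proof.
have [->|s0] := eqVneq s [::]; first by exists 0.
move=> ls; suff [p <-] : exists p, bits_of_pos p = s.
  by exists (nat_of_bin (BinNums.Npos p)); rewrite /bits nat_of_binK.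
elim: s s0 ls => // x s IH _ /=; have [->|s0] := eqVneq s [::].
  by case: x => // _; exists BinNums.xH.
have lE y : last y s = last true s by case: (s) s0.
by rewrite lE => /(IH s0)[p <-]; case: x; [exists (BinNums.xI p) | exists (BinNums.xO p)].
Qed.

(** The most significant difference is read last and decides; without leading zeros a longer numeral
    is larger. *)
Lemma compare_bitsP c s t : last true s -> last true t ->
  compare_bits c s t =
  if bits_value s == bits_value t then c else Some (bits_value t < bits_value s).
Proof.
have pos x s' : last true (x :: s') -> 0 < bits_value (x :: s').
  elim: s' x => [|y s' IH] x /=; first by case: x.
  by move/(IH y) => /=; lia.
have tl x s' : last true (x :: s') -> last true s' by case: s'.
elim: s t c => [|x s IH] [|y t] c // ls lt.
- by rewrite /= ltn_eqF ?ltn0 // (pos y t).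
- by rewrite /= gtn_eqF ?(pos x s).
rewrite [LHS]/= IH ?(tl x s) ?(tl y t) //=.
move: (bits_value s) (bits_value t) => m m' {ls lt IH}.
have [lt|gt|->] := ltngtP m m'.
- have -> : (x + m.*2 == y + m'.*2) = false by case: x; case: y; lia.
  by congr Some; case: x; case: y; lia.
- have -> : (x + m.*2 == y + m'.*2) = false by case: x; case: y; lia.
  by congr Some; case: x; case: y; lia.
by rewrite eqn_add2r ltn_add2r; case: x; case: y.
Qed.

Lemma seq_lift (T U : eqType) (f : T -> U) (s : seq U) :
  (forall x, x \in s -> exists y, f y = x) -> exists t, map f t = s.
Proof.
elim: s => [|x s IH] ex; first by exists [::].
have [y yx] := ex x (mem_head _ _).
have [|t ts] := IH; first by move=> z zs; apply: ex; rewrite inE zs orbT.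
by exists (y :: t); rewrite /= yx ts.
Qed.

Lemma pairwise_mem (T : eqType) (r : rel T) s :
  {in s &, forall x y, r x y -> r y x} -> {in s, forall x, r x x} -> pairwise r s ->
  {in s &, forall x y, r x y}.
Proof.
elim: s => [|z s IH] //= rC rR /andP[/allP az ps] x y.
rewrite !inE => /orP[/eqP->|xs] /orP[/eqP->|ys].
- by apply: rR; rewrite mem_head.
- exact: az.
- by apply: rC; rewrite ?mem_head ?inE ?xs ?orbT // az.
apply: IH xs ys => //.
  by move=> a b sa sb; apply: rC; rewrite inE ?sa ?sb orbT.
by move=> a sa; apply: rR; rewrite inE sa orbT.
Qed.

Lemma mem_pairwise (T : eqType) (r : rel T) s :
  {in s &, forall x y, r x y} -> pairwise r s.
Proof.
elim: s => //= z s IH h; apply/andP; split.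
  by apply/allP => x xs; apply: h; rewrite ?mem_head ?inE ?xs ?orbT.
by apply: IH => x y xs ys; apply: h; rewrite inE ?xs ?ys orbT.
Qed.

Section Verifier.
Variables (k V : nat) (rho : rat).

Notation payload := (payload V).
Notation J := #|{: payload}|.
Notation letter := (letter symbol J).

Definition decode (i : label J) : payload := nth (None, false, false) (enum {: payload}) i.
Definition encode (x : payload) : label J := inord (index x (enum {: payload})).

Lemma encodeK : cancel encode decode.
Proof.
move=> x; rewrite /decode /encode inordK ?nth_index ?mem_enum //.
by rewrite ltnS cardE ltnW // index_mem mem_enum.
Qed.

Definition letter_bit (x : letter) : option bool :=
  if x is Some (Bit b, _) then Some b else None.
(** The end marker is a starter so that the header numeral [n] gets compared with every variable
    index. *)
Definition letter_starter (x : letter) : bool :=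
  match x with None | Some (Sign _, _) => true | _ => false end.
Definition letter_sep (x : letter) : bool :=
  if x is Some (NewClause, _) then true else false.

Definition letter_related (x y : letter) (same_clause : bool) (c : option bool) : bool :=
  match x, y with
  | None, Some (Sign _, _) => c == Some true
  | Some (Sign _, i), Some (Sign _, j) => compatible (decode i) (decode j) same_clause (c == None)
  | _, _ => true
  end.

(* [None] is the rejecting sink.  Otherwise the first component is [None] in the
   header and the number of literals read so far inside a clause, and the second
   one says whether the current numeral has no leading zero. *)
Definition grammar_state := option (option 'I_k.+1 * bool).

Definition grammar_step (q : grammar_state) (x : letter) : grammar_state :=
  match q, x with
  | _, None => q
  | Some (None, _), Some (Bit b, _) => Some (None, b)
  | Some (Some i, _), Some (Bit b, _) => if i == 0 :> nat then None else Some (Some i, b)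
  | Some (_, true), Some (NewClause, _) => Some (Some ord0, true)
  | Some (Some i, true), Some (Sign _, _) => if i < k then Some (Some (inord i.+1), true) else None
  | _, _ => None
  end.

Definition grammar_final (q : grammar_state) : bool := if q is Some (_, ok) then ok else false.

(* Evaluation of a formula: have all finished clauses been satisfied, has the
   current one, and has it a tagged positive, a tagged negative literal. *)
Definition eval_state := (bool * bool * bool * bool)%type.

Definition eval_done (q : eval_state) : bool :=
  let: (al, cu, tp, tn) := q in al && (cu || tp && tn).

Definition eval_step (tr : bool -> payload -> bool) (q : eval_state) (x : letter) : eval_state :=
  let: (al, cu, tp, tn) := q in
  match x with
  | Some (NewClause, _) => (eval_done q, false, false, false)
  | Some (Sign s, i) =>
      (al, cu || tr s (decode i), tp || tagged_taut (decode i) && s, tn || tagged_taut (decode i) && ~~ s)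
  | _ => q
  end.

Definition agree_step (a : {ffun 'I_V -> bool}) (q : bool) (x : letter) : bool :=
  if x is Some (Sign _, i) then q && guess_agrees a (decode i) else q.

Definition truth (a : option {ffun 'I_V -> bool}) : bool -> payload -> bool :=
  if a is Some a then branch_true a else @guess_true V.

(** All [2 ^ V] branches are evaluated in parallel, together with the guess at index [None]; [V] is
    fixed, so this is a finite type. *)
Definition count_state :=
  ({ffun option {ffun 'I_V -> bool} -> eval_state} * {ffun {ffun 'I_V -> bool} -> bool})%type.

Definition count_step (q : count_state) (x : letter) : count_state :=
  ([ffun a => eval_step (truth a) (q.1 a) x], [ffun a => agree_step a (q.2 a) x]).

Definition count_final (q : count_state) : bool :=
  let G := [set a | eval_done (q.1 (Some a))] in
  let g : rat := #|G|%:R%R in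
  (rho * 2%:R ^+ V <= g)%R && ((rho * 2%:R ^+ V < g)%R ||
    eval_done (q.1 None) && [exists a, (a \notin G) && q.2 a]).

Definition verifier_state := (grammar_state * count_state)%type.
(** The current clause starts out satisfied, so that the first [NewClause] closes a vacuous one. *)
Definition verifier_start : verifier_state :=
  (Some (None, true), ([ffun=> (true, true, false, false)], [ffun=> true])).
Definition verifier_step (q : verifier_state) (x : letter) : verifier_state :=
  (grammar_step q.1 x, count_step q.2 x).
Definition verifier_final (q : verifier_state) : bool := grammar_final q.1 && count_final q.2.

Definition verify : seq letter -> bool :=
  check verifier_start verifier_step verifier_final letter_bit letter_starter letter_sep letter_related.

Notation block := (block letter_bit).
Notation tokens := (tokens letter_bit letter_starter letter_sep).
Notation tokrel := (tokrel letter_related).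

Lemma starter_bit x : letter_starter x -> letter_bit x = None.
Proof. by case: x => [[[]]|]. Qed.

(* Only the labels of the [Sign] symbols matter. *)
Definition normalize (x : letter) : letter :=
  match x with
  | None | Some (Sign _, _) => x
  | Some (y, _) => Some (y, ord0)
  end.

(** The certificate may label the other symbols arbitrarily; normalizing brings every accepted word
    to the form [word h Phi]. *)
Lemma verify_normalize z : verify (map normalize z) = verify z.
Proof.
have foldE q : foldl verifier_step q (map normalize z) = foldl verifier_step q z.
  elim: z q => //= x z IH q; rewrite IH; congr foldl.
  by case: x => [[[]]|].
have blockE y : block (map normalize y) = block y.
  by elim: y => //= x y IH; case: x => [[[]]|] //=; rewrite IH.
have tokensE cl : tokens cl (map normalize z) = tokens cl z.
  elim: z cl {foldE} => //= x z IH cl; rewrite blockE IH.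
  by case: x => [[[]]|].
by rewrite /verify /check foldE tokensE.
Qed.

(* A literal read off the tape: its sign, label and variable numeral. *)
Definition raw_literal := (bool * label J * seq bool)%type.
Implicit Types (l : raw_literal) (c : seq raw_literal) (Phi : seq (seq raw_literal)).

Definition word_bits (s : seq bool) : seq letter := [seq Some (Bit b, ord0) | b <- s].
Definition word_literal l : seq letter := Some (Sign l.1.1, l.1.2) :: word_bits l.2.
Definition word_literals c := flatten (map word_literal c).
Definition word_clauses Phi : seq letter :=
  flatten [seq Some (NewClause, ord0) :: word_literals c | c <- Phi].
Definition word h Phi : seq letter := None :: word_bits h ++ word_clauses Phi.

Definition canonical l : bool := last true l.2.
Definition well_formed Phi : bool := all (fun c => (size c <= k) && all canonical c) Phi.

Definition view l : bool * payload := (l.1.1, decode l.1.2).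

Lemma block_literals c r : block r = [::] -> block (word_literals c ++ r) = [::].
Proof. by case: c. Qed.

Lemma block_clauses Phi : block (word_clauses Phi) = [::].
Proof. by case: Phi. Qed.

Lemma block_bits h r : block r = [::] -> block (word_bits h ++ r) = h.
Proof. by move=> br; elim: h => //= b h ->. Qed.

Lemma tokens_bits cl h r : tokens cl (word_bits h ++ r) = tokens cl r.
Proof. by elim: h => //= b h; rewrite addn0. Qed.

Definition literal_token cl l : token symbol J := (Some (Sign l.1.1, l.1.2), l.2, cl).

Lemma tokens_literals cl c r : block r = [::] ->
  tokens cl (word_literals c ++ r) = map (literal_token cl) c ++ tokens cl r.
Proof.
move=> br; elim: c => //= l c IH; rewrite addn0 -catA tokens_bits IH.
by rewrite block_bits // block_literals.
Qed.

Fixpoint clause_tokens cl Phi :=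
  if Phi is c :: Phi' then map (literal_token cl.+1) c ++ clause_tokens cl.+1 Phi' else [::].

Lemma tokens_clauses cl Phi : tokens cl (word_clauses Phi) = clause_tokens cl Phi.
Proof.
elim: Phi cl => //= c Phi IH cl.
by rewrite addn1 tokens_literals ?block_clauses // IH.
Qed.

Lemma tokens_word h Phi : tokens 0 (word h Phi) = (None, h, 0) :: clause_tokens 0 Phi.
Proof. by rewrite /= addn0 tokens_bits tokens_clauses block_bits ?block_clauses. Qed.

Lemma mem_clause_tokens cl Phi t : reflect
  (exists i l, [/\ i < size Phi, l \in nth [::] Phi i & t = literal_token (cl + i).+1 l])
  (t \in clause_tokens cl Phi).
Proof.
elim: Phi cl t => [|c Phi IH] cl t /=; first by constructor=> -[i [l []]].
rewrite mem_cat; apply: (iffP orP) => [[/mapP[l lc ->]|/IH[i [l [si li ->]]]]|[[|i] [l [si li ->]]]].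
- by exists 0, l; rewrite addn0.
- by exists i.+1, l; rewrite addnS.
- by left; rewrite addn0; apply: map_f.
- by right; apply/IH; exists i, l; rewrite addnS.
Qed.

Lemma eval_word tr q h Phi : eval_done q ->
  eval_done (foldl (eval_step tr) q (word h Phi)) = all (clause_ok tr) (map (map view) Phi).
Proof.
have bitsE q' s : foldl (eval_step tr) q' (word_bits s) = q'.
  by elim: s q' => //= b s IH [[[al cu] tp] tn].
have litsE al cu tp tn c : foldl (eval_step tr) (al, cu, tp, tn) (word_literals c) =
    (al, cu || has (fun o => tr o.1 o.2) (map view c),
     tp || has (fun o => tagged_taut o.2 && o.1) (map view c),
     tn || has (fun o => tagged_taut o.2 && ~~ o.1) (map view c)).
  elim: c cu tp tn => [|l c IH] cu tp tn; first by rewrite /= !orbF.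
  by rewrite [word_literals _]/= /= foldl_cat bitsE IH !orbA.
have clausesE q' : eval_done (foldl (eval_step tr) q' (word_clauses Phi)) =
    eval_done q' && all (clause_ok tr) (map (map view) Phi).
  elim: Phi q' => [|c Phi IH] q'; first by rewrite andbT.
  rewrite [word_clauses _]/= /= foldl_cat; case: q' => [[[al cu] tp] tn].
  by rewrite litsE IH /= andbA.
move=> qd; rewrite /= foldl_cat bitsE clausesE.
by case: q qd => [[[al cu] tp] tn] ->.
Qed.

Lemma agree_word a h Phi : foldl (agree_step a) true (word h Phi) =
  all (fun o => guess_agrees a o.2) (flatten (map (map view) Phi)).
Proof.
have bitsE q s : foldl (agree_step a) q (word_bits s) = q by elim: s.
have litsE q c : foldl (agree_step a) q (word_literals c) = q && all (fun o => guess_agrees a o.2) (map view c).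
  elim: c q => [|l c IH] q; first by rewrite andbT.
  by rewrite [word_literals _]/= /= foldl_cat bitsE IH andbA.
suff clausesE q : foldl (agree_step a) q (word_clauses Phi) =
    q && all (fun o => guess_agrees a o.2) (flatten (map (map view) Phi)).
  by rewrite /= foldl_cat bitsE clausesE.
elim: Phi q => [|c Phi IH] q; first by rewrite andbT.
by rewrite [word_clauses _]/= /= foldl_cat litsE IH all_cat andbA.
Qed.

Lemma count_word h Phi :
  count_final (foldl count_step verifier_start.2 (word h Phi)) = enough rho (map (map view) Phi).
Proof.
have runE z q : (foldl count_step q z) =
    ([ffun a => foldl (eval_step (truth a)) (q.1 a) z], [ffun a => foldl (agree_step a) (q.2 a) z]).
  elim: z q => [|x z IH] q /=.
    by case: q => q1 q2; congr (_, _); apply/ffunP => a; rewrite ffunE.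
  by rewrite IH; congr (_, _); apply/ffunP => a; rewrite !ffunE.
rewrite runE /count_final /enough.
set G := [set a | _]; have -> : G = good_branches (map (map view) Phi).
  by apply/setP => a; rewrite !inE !ffunE eval_word.
rewrite !ffunE eval_word //; congr (_ && (_ || _ && _)); apply: eq_existsb => a.
by rewrite !ffunE agree_word.
Qed.

Lemma grammar_run_bits m ok h : (m == Some ord0 -> h = [::]) ->
  foldl grammar_step (Some (m, ok)) (word_bits h) = Some (m, last ok h).
Proof.
elim: h ok => //= b h IH ok m0.
have m0' : m != Some ord0 by apply/negP => /m0.
have {}IH := IH b (fun e => False_ind _ (negP m0' e)).
case: m m0 m0' IH => [i|] _ i0 IH; rewrite /= if_same //.
case: ifP => [/eqP e|_]; last exact: IH.
by case/negP: i0; apply/eqP; congr Some; apply: val_inj.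
Qed.

Lemma grammar_run_literals i c : i + size c <= k -> all canonical c ->
  foldl grammar_step (Some (Some (inord i), true)) (word_literals c) =
  Some (Some (inord (i + size c)), true).
Proof.
elim: c i => [|l c IH] i /=; first by rewrite addn0.
rewrite -addSnnS => le /andP[lc cc].
have ik : i < k by apply: leq_trans le; rewrite leq_addr.
have -> : (inord i : 'I_k.+1) = i :> nat by rewrite inordK // ltnS ltnW.
rewrite ik foldl_cat grammar_run_bits; first by rewrite (lc : last true l.2 = true) IH.
by case/eqP => /(congr1 val); rewrite /= inordK.
Qed.

Lemma grammar_complete h Phi : last true h -> well_formed Phi ->
  grammar_final (foldl grammar_step (Some (None, true)) (word h Phi)).
Proof.
move=> lh; rewrite /= foldl_cat grammar_run_bits // lh.
elim: Phi (None : option 'I_k.+1) => //= c Phi IH m /andP[/andP[szc cc] wf].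
have ord0E : ord0 = inord 0 :> 'I_k.+1 by apply: val_inj; rewrite /= inordK.
rewrite foldl_cat (_ : match m with Some _ => _ | None => _ end = Some (Some (inord 0), true)).
  by rewrite grammar_run_literals // IH.
by rewrite -ord0E; case: m.
Qed.

(** The shape of what remains to be read from [q]: the rest [h] of a numeral, the rest [c] of a
    clause, then whole clauses; [i] counts the literals of the clause already read. *)
Definition parsed (q : grammar_state) (z : seq letter) : Prop :=
  exists h c Phi, [/\ z = word_bits h ++ word_literals c ++ word_clauses Phi,
    all canonical c, well_formed Phi &
    if q is Some (m, ok) then
      last ok h /\ (if m is Some i then size c + i <= k /\ (i = 0 :> nat -> h = [::]) else c = [::])
    else False].

Lemma grammar_parse q z :
  grammar_final (foldl grammar_step q (map Some z)) -> parsed q (map (normalize \o Some) z).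
Proof.
have sink y : grammar_final (foldl grammar_step None (map Some y)) = false.
  by elim: y => // -[x i] y.
elim: z q => [|[x j] z IH] q /=.
  case: q => [[m ok]|//] /= okT; exists [::], [::], [::]; split=> //; split=> //.
  by case: m => [i|//]; split=> //=; rewrite add0n -ltnS ltn_ord.
case: q => [[m ok]|] /=; last by rewrite sink.
case: x => [b|s|].
- case: m => [i|]; rewrite if_same.
    case: ifP => [_|/eqP i0]; first by rewrite sink.
    case/IH=> h [c [Phi [-> cc wf [lh [szc _]]]]].
    by exists (b :: h), c, Phi; split.
  case/IH=> h [c [Phi [-> cc wf [lh c0]]]].
  by exists (b :: h), c, Phi; split.
- case: m => [i|]; last by case: ok; rewrite sink.
  case: ok; last by rewrite sink.
  case: ifP => ik; last by rewrite sink.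
  case/IH=> h [c [Phi [-> cc wf [lh [szc _]]]]].
  exists [::], ((s, j, h) :: c), Phi; split=> //; first by rewrite /= -catA.
    by rewrite /= cc andbT.
  by split=> //; split=> //; move: szc; rewrite inordK //= addnS.
case: ok; last by case: m => [i|]; rewrite sink.
move=> acc; have {acc} : parsed (Some (Some ord0, true)) (map (normalize \o Some) z).
  by apply: IH; case: m acc.
case=> h [c [Phi [-> cc wf [lh [szc /(_ erefl) h0]]]]].
exists [::], [::], (c :: Phi); split=> //; rewrite ?h0 //=.
  by rewrite cc -[size c]addn0 szc.
by split=> //; case: m => // i; rewrite add0n -ltnS ltn_ord.
Qed.

Lemma verify_word h Phi : last true h -> well_formed Phi ->
  verify (word h Phi) =
  enough rho (map (map view) Phi) &&
  (all (fun l => compare_bits None h l.2 == Some true) (flatten Phi) &&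
   pairwise tokrel (clause_tokens 0 Phi)).
Proof.
move=> lh wf; rewrite /verify /check.
have -> : verifier_final (foldl verifier_step verifier_start (word h Phi)) = enough rho (map (map view) Phi).
  have runE z q : foldl verifier_step q z = (foldl grammar_step q.1 z, foldl count_step q.2 z).
    by elim: z q => [|x z IH] [q1 q2] //=; rewrite IH.
  by rewrite runE /verifier_final grammar_complete // count_word.
rewrite tokens_word /=; congr (_ && (_ && _)).
apply/allP/allP => [H l /flattenP[c cP lc]|H t].
  have cS : index c Phi < size Phi by rewrite index_mem.
  have := H (literal_token (index c Phi).+1 l); apply.
  by apply/mem_clause_tokens; exists (index c Phi), l; rewrite nth_index.
case/mem_clause_tokens=> i [l [si li ->]]; apply: H.
by apply/flattenP; exists (nth [::] Phi i) => //; apply: mem_nth.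
Qed.

Definition raw n (o : literal n * label J) : raw_literal := (o.1.2, o.2, bits o.1.1).

(** The machine tests each pair once. Since [compatible] is symmetric, and reflexive for equal
    variables, all ordered pairs follow; compatibility within a clause implies that across
    clauses. *)
Lemma pairwise_raw n (Psi : seq (seq (literal n * label J))) :
  reflect (consistent (map (map (fun o => (o.1, decode o.2))) Psi))
    (pairwise tokrel (clause_tokens 0 (map (map (@raw n)) Psi))).
Proof.
set Phi := map (map (@raw n)) Psi.
have cmpE (o o' : literal n * label J) :
    (compare_bits None (bits o.1.1) (bits o'.1.1) == None) = (o.1.1 == o'.1.1).
  rewrite compare_bitsP ?last_bits // !bits_value_bits.
  by case: (eqVneq (o.1.1 : nat) o'.1.1) => [/val_inj->|ne]; rewrite ?eqxx //= -(inj_eq val_inj) (negbTE ne).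
have tokE i j (o o' : literal n * label J) : tokrel (literal_token i (raw o)) (literal_token j (raw o')) =
    compatible (decode o.2) (decode o'.2) (i == j) (o.1.1 == o'.1.1).
  by rewrite -cmpE.
have tokP t : t \in clause_tokens 0 Phi -> exists i o, [/\ i < size Psi, o \in nth [::] Psi i & t = literal_token i.+1 (raw o)].
  case/mem_clause_tokens=> i [l []]; rewrite size_map => si.
  by rewrite (nth_map [::]) // => /mapP[o oi ->] ->; exists i, o.
have Ptok i o : i < size Psi -> o \in nth [::] Psi i -> literal_token i.+1 (raw o) \in clause_tokens 0 Phi.
  by move=> si oi; apply/mem_clause_tokens; exists i, (raw o); rewrite size_map (nth_map [::]) // map_f.
have compC x y s e : @compatible V x y s e -> compatible y x s e.
  rewrite /compatible => /and3P[h1 h2 h3]; apply/and3P; split.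
  - by rewrite eq_sym.
  - by move: h2; case: (branch x) => [i|]; case: (branch y) => [j|] //; rewrite (eq_sym j).
  - by rewrite -andbA [tagged_taut y && _]andbC andbA.
have compR x s : @compatible V x x s true.
  by rewrite /compatible eqxx !implybT andbT; case: (branch x) => // i; rewrite eqxx.
have compW x y e s : @compatible V x y true e -> compatible x y s e.
  by case/and3P=> h1 h2 h3; apply/and3P; split=> //; case: s.
apply: (iffP idP) => [pw|[cons1 cons2]].
- have all2 := pairwise_mem _ _ pw.
  have {}all2 : {in clause_tokens 0 Phi &, forall t u, tokrel t u}.
    apply: all2 => [t u /tokP[i [o [_ _ ->]]] /tokP[j [o' [_ _ ->]]]|t /tokP[i [o [_ _ ->]]]].
      by rewrite !tokE [j.+1 == _]eq_sym [o'.1.1 == _]eq_sym; apply: compC.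
    by rewrite tokE !eqxx.
  split=> [o o'|c o o' /mapP[d dP ->] /mapP[p pd ->] /mapP[p' pd' ->]].
    case/flattenP=> _ /mapP[d dP ->] /mapP[p pd ->] /flattenP[_ /mapP[d' dP' ->] /mapP[p' pd' ->]].
    have := all2 _ _ (Ptok (index d Psi) p _ _) (Ptok (index d' Psi) p' _ _).
    rewrite !index_mem !nth_index // => /(_ dP pd dP' pd'); rewrite tokE.
    by case/and3P=> h1 h2 h3; apply/and3P; split.
  have := all2 _ _ (Ptok (index d Psi) p _ _) (Ptok (index d Psi) p' _ _).
  by rewrite !index_mem !nth_index // => /(_ dP pd dP pd'); rewrite tokE eqxx.
apply: mem_pairwise => t u /tokP[i [o [si oi ->]]] /tokP[j [o' [sj oj ->]]]; rewrite tokE.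
have memF (m : nat) p : m < size Psi -> p \in nth [::] Psi m ->
    (p.1, decode p.2) \in flatten (map (map (fun o => (o.1, decode o.2))) Psi).
  move=> sm pm; apply/flattenP; exists (map (fun o => (o.1, decode o.2)) (nth [::] Psi m)).
    by apply: map_f; apply: mem_nth.
  exact: (map_f (fun o : literal n * label J => (o.1, decode o.2))).
case: eqP => [[ij]|_]; last exact: (cons1 _ _ (memF _ _ si oi) (memF _ _ sj oj)).
rewrite -ij in oj; apply: (cons2 _ (_, _) (_, _) (map_f _ (mem_nth [::] si))).
  exact: (map_f (fun o : literal n * label J => (o.1, decode o.2)) oi).
exact: (map_f (fun o : literal n * label J => (o.1, decode o.2)) oj).
Qed.

Definition letter_symbol (x : letter) : symbol := if x is Some (s, _) then s else NewClause.
Definition letter_label (x : letter) : label J := if x is Some (_, i) then i else ord0.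

Lemma map_symbol_word n (Psi : seq (seq (literal n * label J))) :
  map letter_symbol (word (bits n) (map (map (@raw n)) Psi)) =
  NewClause :: encode_cnf (map (map fst) Psi).
Proof.
have bitsE s : map letter_symbol (word_bits s) = map Bit s by rewrite -map_comp.
rewrite /= map_cat bitsE /encode_cnf; congr (_ :: _ ++ _).
rewrite map_flatten -!map_comp; congr flatten; apply: eq_map => c /=.
rewrite /encode_clause /word_literals map_flatten -!map_comp; congr (_ :: flatten _).
by apply: eq_map => o; rewrite /= bitsE.
Qed.

Lemma word_zip h Phi (w := behead (word h Phi)) :
  w = map Some (zip (map letter_symbol w) (map letter_label w)).
Proof.
have : all isSome w.
  rewrite /w /= all_cat; apply/andP; split; first by apply/allP => _ /mapP[b _ ->].
  apply/allP => x /flattenP[_ /mapP[c _ ->]]; rewrite inE => /orP[/eqP->//|].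
  by case/flattenP=> _ /mapP[l _ ->]; rewrite inE => /orP[/eqP->//|/mapP[b _ ->]].
by elim: w => [|[[y i]|] w IH] //= /IH {1}->.
Qed.

Lemma verify_header n (Psi : seq (seq (literal n * label J))) :
  all (fun l => compare_bits None (bits n) l.2 == Some true) (flatten (map (map (@raw n)) Psi)).
Proof.
apply/allP => l /flattenP[_ /mapP[c _ ->] /mapP[o _ ->]] /=.
by rewrite compare_bitsP ?last_bits // !bits_value_bits gtn_eqF ?ltn_ord.
Qed.

Lemma verify_raw n (Psi : seq (seq (literal n * label J))) :
  all (fun d => size d <= k) Psi ->
  verify (word (bits n) (map (map (@raw n)) Psi)) <->
  (enough rho (map (@signs V n) (map (map (fun o => (o.1, decode o.2))) Psi)) /\
   consistent (map (map (fun o => (o.1, decode o.2))) Psi)).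
Proof.
move=> szPsi; rewrite verify_word ?last_bits //; last first.
  rewrite /well_formed all_map; apply: sub_all szPsi => c /= szc; rewrite size_map szc.
  by apply/allP => _ /mapP[o _ ->]; apply: last_bits.
rewrite verify_header andTb.
have -> : map (map view) (map (map (@raw n)) Psi) =
    map (@signs V n) (map (map (fun o => (o.1, decode o.2))) Psi).
  by rewrite -!map_comp; apply: eq_map => c /=; rewrite /signs -!map_comp.
by split=> [/andP[-> /pairwise_raw]|[-> /pairwise_raw]].
Qed.

(** The grammar yields [word h Phi] with [h] the numeral of some [n]; comparison with the header
    puts all variable indices below [n], which lifts the raw literals to literals over ['I_n]. *)
Lemma certified_GtTHR (w : seq symbol) (s : seq (label J)) : size s = size w ->
  verify (None :: map Some (zip w s)) -> GtTHR_kSAT rho k w.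
Proof.
move=> szs; rewrite -verify_normalize => ver.
have : grammar_final (foldl grammar_step (Some (None, true)) (map Some (zip w s))).
  move: ver; rewrite verify_normalize => /andP[/andP[+ _] _].
  have runE z q : (foldl verifier_step q z).1 = foldl grammar_step q.1 z.
    by elim: z q => [|x z IH] [q1 q2] //=; rewrite IH.
  by rewrite runE.
case/grammar_parse=> h [c [Phi [zE _ wf [lh c0]]]]; rewrite {}c0 {c} /= in zE.
have {}ver : verify (word h Phi) by move: ver; rewrite /= -map_comp zE.
have [n nh] := bits_surj lh.
have [Psi PsiE] : exists Psi, map (map (@raw n)) Psi = Phi.
  apply: seq_lift => c cP; apply: seq_lift => l lc.
  move: ver; rewrite verify_word // => /andP[_ /andP[/allP/(_ l) hl _]].
  have {hl} : compare_bits None h l.2 == Some true by apply: hl; apply/flattenP; exists c.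
  have lc' : last true l.2 by have /andP[_ /allP/(_ l lc)] := allP wf c cP.
  have [m me] := bits_surj lc'.
  rewrite compare_bitsP // -nh -me !bits_value_bits.
  case: ifP => // _ gt; have mn : m < n by case: (m < n) gt.
  exists ((Ordinal mn, l.1.1), l.1.2).
  by rewrite /raw /= me -!surjective_pairing.
have szPsi : all (fun d => size d <= k) Psi.
  move: wf; rewrite -PsiE /well_formed all_map; apply: sub_all => c /= /andP[].
  by rewrite size_map.
move: ver; rewrite -PsiE -nh => /(verify_raw szPsi)[en cons].
exists n, (map (map fst) Psi); split.
- have := map_symbol_word Psi; rewrite PsiE nh /word /= -zE => -[<-].
  rewrite -map_comp -[LHS](unzip1_zip (t := s)) ?szs // /unzip1; apply: eq_map => -[x i] /=.
  by case: x.
- by rewrite /is_kcnf all_map; apply: sub_all szPsi => c /=; rewrite size_map.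
have := certificate_sound cons en.
by rewrite -map_comp; under eq_map do rewrite /= -map_comp.
Qed.

Lemma GtTHR_certified (complete : forall n (phi : cnf n),
    is_kcnf k phi -> (rho * 2%:R ^+ n < (num_sat phi)%:R)%R ->
    exists Psi : seq (seq (occurrence V n)),
      [/\ map (map fst) Psi = phi, consistent Psi & enough rho (map (@signs V n) Psi)]) w :
  GtTHR_kSAT rho k w ->
  exists2 s : seq (label J), size s = size w & verify (None :: map Some (zip w s)).
Proof.
case=> n [phi [-> kphi gt]]; have [Psi0 [phiE cons en]] := complete n phi kphi gt.
pose Psi := map (map (fun o : occurrence V n => (o.1, encode o.2))) Psi0.
have Psi0E : map (map (fun o : literal n * label J => (o.1, decode o.2))) Psi = Psi0.
  rewrite -map_comp map_id_in // => c _ /=; rewrite -map_comp map_id_in // => -[o x] _ /=.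
  by rewrite encodeK.
have PsiE : map (map fst) Psi = phi.
  by rewrite -phiE -map_comp; apply: eq_map => c /=; rewrite -map_comp.
have szPsi : all (fun d => size d <= k) Psi.
  move: kphi; rewrite -PsiE /is_kcnf all_map; apply: sub_all => c /=; by rewrite size_map.
have ver : verify (word (bits n) (map (map (@raw n)) Psi)).
  by apply/(verify_raw szPsi); rewrite Psi0E.
have := word_zip (bits n) (map (map (@raw n)) Psi).
set W := behead _ => /= WE.
have symE : map letter_symbol W = encode_cnf phi.
  by have [] := map_symbol_word Psi; rewrite PsiE.
exists (map letter_label W); first by rewrite -symE !size_map.
by rewrite -symE -WE.
Qed.

End Verifier.

Unset Implicit Arguments.

Theorem theorem7p10 (k : nat) (B : nat) (rho : rat) (hk : (0 < k)%N)
    (hrho0 : (0 < rho)%R) (hrho1 : (rho < 1)%R)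
    (hB : (denq rho <= Posz B)%R) :
  in_NP (GtTHR_kSAT rho k).
Proof.
have [V complete] := certificate_complete k rho.
apply: (annotated_check_in_NP (q0 := verifier_start k V) (dfa := @verifier_step k V)
  (final := verifier_final rho) (sep := @letter_sep V) (related := @letter_related V)
  (@starter_bit V)) => w.
split; [exact: (GtTHR_certified complete) | by case=> s; apply: certified_GtTHR].
Qed.
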